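(* Let $\overline n=(n_1,\ldots,n_r)$ be a tuple of positive integers with $n_1\le n_i$ for all $i$. There is a homotopy equivalence $$\Sigma P_{\overline n}\simeq\bigvee_{\overline u\subseteq(n_2,\ldots,n_r)}\Sigma^{1-\ell(\overline u)}P_{|\overline u|+\ell(\overline u)}^{n_1+|\overline u|+\ell(\overline u)},$$ where, if $\overline u=(u_1,\ldots,u_s)$, then $|\overline u|:=u_1+\cdots+u_s$ and $\ell(\overline u):=s$.
   Context: For a tuple $\overline n=(n_1,\ldots,n_r)$ of positive integers, the projective product space is $P_{\overline n}=S^{n_1}\times\cdots\times S^{n_r}/((x_1,\ldots,x_r)\sim(-x_1,\ldots,-x_r))$, where $x_i\in S^{n_i}$. The wedge is over all sub-tuples $\overline u$ of the ordered tuple $(n_2,\ldots,n_r)$, chosen by positions (so entries may repeat and there are $2^{r-1}$ summands), including the empty one. $P_n^k=RP^k/RP^{n-1}$ denotes a stunted real projective space; for the empty sub-tuple, $RP^{-1}=\emptyset$ and $P_0^{n_1}$ means $RP^{n_1}$ itself (no disjoint basepoint is added), so that this summand is $\Sigma RP^{n_1}$. For $\ell(\overline u)>1$, $\Sigma^{1-\ell(\overline u)}P_{|\overline u|+\ell(\overline u)}^{n_1+|\overline u|+\ell(\overline u)}$ denotes the $(\ell(\overline u)-1)$-fold desuspension of the stunted projective space, i.e. a space whose $(\ell(\overline u)-1)$-fold suspension is the stunted projective space; these desuspensions exist for dimensional reasons. *)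

(* Defs.v *)
From HB Require Import structures.
From mathcomp Require Import all_boot all_order all_algebra generic_quotient.
From mathcomp Require Import all_classical all_reals topology homotopy.
From mathcomp Require Import normedtype.
Set Implicit Arguments.
Unset Strict Implicit.
Unset Printing Implicit Defensive.
Import Order.TTheory GRing.Theory Num.Theory.
Import numFieldNormedType.Exports.
Local Open Scope classical_set_scope.
Local Open Scope ring_scope.
Local Open Scope quotient_scope.

HB.instance Definition _ (T U : ptopologicalType) := Pointed.on (T * U)%type.

Section mod_involution.
Context {T : ptopologicalType} (a : T -> T) (aK : involutive a).

Let rel (x y : T) := (x == y) || (x == a y).

Let rel_refl : reflexive rel.
Proof. by move=> x; rewrite /rel eqxx. Qed.

Let rel_sym : symmetric rel.
Proof.
suff h x y : rel x y -> rel y x by move=> x y; apply/idP/idP; exact: h.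
by case/orP => /eqP ->; rewrite /rel ?aK eqxx ?orbT.
Qed.

Let rel_trans : transitive rel.
Proof.
by move=> y x z /orP[]/eqP -> /orP[]/eqP ->; rewrite /rel ?aK eqxx ?orbT.
Qed.

Definition involution_rel := EquivRel rel rel_refl rel_sym rel_trans.

Definition mod_involution := quotient_topology {eq_quot involution_rel}.

HB.instance Definition _ := PointedTopological.on mod_involution.
HB.instance Definition _ := Quotient.on mod_involution.

End mod_involution.

(* The subset [A] is identified to a point. If [A] is empty then nothing is
   identified, and in particular no disjoint base point is added. The base
   point of [collapse A] is the class of the base point of [T], whether or not
   that point belongs to [A]. *)
Section collapse.
Context {T : ptopologicalType} (A : set T).

Let rel (x y : T) := (x == y) || ((x \in A) && (y \in A)).

Let rel_refl : reflexive rel.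
Proof. by move=> x; rewrite /rel eqxx. Qed.

Let rel_sym : symmetric rel.
Proof. by move=> x y; rewrite /rel eq_sym andbC. Qed.

Let rel_trans : transitive rel.
Proof.
move=> y x z /predU1P[->//|/andP[xA yA]] /predU1P[<-|/andP[_ zA]];
by rewrite /rel ?xA ?yA ?zA orbT.
Qed.

Definition collapse_rel := EquivRel rel rel_refl rel_sym rel_trans.

Definition collapse := quotient_topology {eq_quot collapse_rel}.

HB.instance Definition _ := PointedTopological.on collapse.
HB.instance Definition _ := Quotient.on collapse.

End collapse.

Section spheres.
Context (R : realType).

Definition sphere_set (k : nat) : set 'rV[R]_k.+1 :=
  [set x | \sum_i x ord0 i ^+ 2 = 1].
Arguments sphere_set : clear implicits.

Definition sphere (k : nat) : Type := set_type (sphere_set k).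

HB.instance Definition _ k := Topological.on (sphere k).

Lemma sphere_base_proof k : delta_mx ord0 ord0 \in sphere_set k.
Proof.
apply/mem_set; rewrite /sphere_set /= (bigD1 ord0) //= big1 => [|i i0].
  by rewrite mxE !eqxx expr1n addr0.
by rewrite mxE eqxx (negbTE i0) expr0n.
Qed.

HB.instance Definition _ k :=
  isPointed.Build (sphere k) (SigSub (sphere_base_proof k)).

Lemma antipode_proof k (x : sphere k) : - \val x \in sphere_set k.
Proof.
have /set_mem xS := valP x; apply/mem_set; rewrite /sphere_set /= -[RHS]xS.
by apply: eq_bigr => i _; rewrite mxE sqrrN.
Qed.

Definition antipode k (x : sphere k) : sphere k := SigSub (antipode_proof x).

Lemma antipodeK k : involutive (@antipode k).
Proof. by move=> x; apply: val_inj; rewrite /= opprK. Qed.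

Definition real_projective (k : nat) : ptopologicalType :=
  mod_involution (@antipodeK k).

(* The standard copy of RP^(m-1) in RP^k, for m <= k.+1; it is empty for m = 0,
   so that [stunted_projective 0 k] is RP^k itself. *)
Definition sub_projective (m k : nat) : set (real_projective k) :=
  \pi_(real_projective k) @`
    [set x : sphere k | forall i : 'I_k.+1, (m <= i)%N -> \val x ord0 i = 0].

Definition stunted_projective (m k : nat) : ptopologicalType :=
  collapse (@sub_projective m k).

Section projective_product.
Context (I : Type) (n : I -> nat).

Definition sphere_product : Type := prod_topology (fun i => sphere (n i)).

HB.instance Definition _ :=
  Topological.copy sphere_product
    (prod_topology (fun i => (sphere (n i) : topologicalType))).
HB.instance Definition _ :=
  isPointed.Build sphere_product (fun i => point : sphere (n i)).

Definition product_antipode (x : sphere_product) : sphere_product :=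
  fun i => antipode (x i).

Lemma product_antipodeK : involutive product_antipode.
Proof.
by move=> x; apply: functional_extensionality_dep => i; exact: antipodeK.
Qed.

Definition projective_product : ptopologicalType :=
  mod_involution product_antipodeK.

End projective_product.

Definition unit_interval : Type := set_type (`[0, 1]%classic : set R).
HB.instance Definition _ := Topological.on unit_interval.

Lemma zero_in01 : (0 : R) \in (`[0, 1]%classic : set R).
Proof. by rewrite mem_setE in_itv /= lexx ler01. Qed.
Lemma one_in01 : (1 : R) \in (`[0, 1]%classic : set R).
Proof. by rewrite mem_setE in_itv /= lexx ler01. Qed.

Definition I0 : unit_interval := SigSub zero_in01.
Definition I1 : unit_interval := SigSub one_in01.

HB.instance Definition _ := isPointed.Build unit_interval I0.

Definition reduced_suspension (X : ptopologicalType) : ptopologicalType :=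
  collapse [set z : X * unit_interval | [\/ z.1 = point, z.2 = I0 | z.2 = I1]].

Definition based_homotopic (X Y : ptopologicalType) (f g : X -> Y) : Prop :=
  exists h : X * unit_interval -> Y,
    [/\ continuous h, forall x, h (x, I0) = f x,
        forall x, h (x, I1) = g x & forall t, h (point, t) = point].

Definition based_homotopy_equivalent (X Y : ptopologicalType) : Prop :=
  exists (f : X -> Y) (g : Y -> X),
    [/\ continuous f /\ f point = point, continuous g /\ g point = point,
        based_homotopic (g \o f) idfun & based_homotopic (f \o g) idfun].

(* [X] is a k-fold desuspension of [Y]. *)
Definition is_desuspension (k : nat) (X Y : ptopologicalType) : Prop :=
  based_homotopy_equivalent (iter k reduced_suspension X) Y.

End spheres.

(* Makes the library's [pwedge] applicable to families indexed by sets. *)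
HB.instance Definition _ (T : finType) :=
  isPointed.Build {set T} (finset.set0 : {set T}).

Section summands.
Context (R : realType) (r : nat) (n : 'I_r.+1 -> nat).

(* [n ord0] is the distinguished first entry of the tuple [n]. A sub-tuple of
   the remaining entries is given by the set [u] of its positions: position
   [i : 'I_r] refers to the entry [n (lift ord0 i)]. Its length is #|u|. *)
Definition subtuple_sum (u : {set 'I_r}) : nat :=
  (\sum_(i in u) n (lift ord0 i))%N.

Definition summand_base (u : {set 'I_r}) : ptopologicalType :=
  stunted_projective R (subtuple_sum u + #|u|)
    (n ord0 + subtuple_sum u + #|u|).

(* Sigma^(1 - #|u|) of [summand_base u], the desuspensions needed when
   #|u| > 1 being those of the given family [D]. *)
Definition summand (D : {set 'I_r} -> ptopologicalType) (u : {set 'I_r}) :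
    ptopologicalType :=
  match #|u| with
  | 0%N => reduced_suspension R (summand_base u)
  | 1%N => summand_base u
  | _ => D u
  end.

End summands.

(* Main.v *)
From HB Require Import structures.
From mathcomp Require Import all_boot all_order all_algebra generic_quotient.
From mathcomp Require Import all_classical all_reals topology homotopy.
From mathcomp Require Import normedtype realfun.
From mathcomp Require Import ring lra.
Require Import Defs.
Set Implicit Arguments.
Unset Strict Implicit.
Unset Printing Implicit Defensive.
Import Order.TTheory GRing.Theory Num.Theory.
Import numFieldNormedType.Exports.
Local Open Scope classical_set_scope.
Local Open Scope ring_scope.
Local Open Scope quotient_scope.

(* [P_n] is the fibrewise product over [RP^(n ord0)] of sphere bundles, each of
   which has a section, namely the first coordinate padded with zeros (this uses
   [n ord0 <= n i]). Replacing a coordinate by this section gives commuting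
   idempotents [e_i] of [P_n] whose images are neighbourhood deformation
   retracts. If [e] is such an idempotent of a based space [Y], with image [A],
   then [Sigma Y] is a coproduct of [Sigma A] and [Sigma (Y / A)] in the based
   homotopy category: the inclusion of [Sigma (Y / A)] is [id - e], that is, [y]
   goes to the loop that runs along [y] and back along [e y], shortened near [A]
   so as to be constant on [A]. Doing this for all [e_i] writes [Sigma P_n] as a
   coproduct of the [Sigma Y_u], where [Y_u] is obtained from the image of the
   composite of the [e_i], [i] not in [u], by collapsing the points fixed by
   some [e_i], [i] in [u]. It remains to see that the [#|u|]-fold suspension of [Y_u]
   is a stunted projective space. [Y_u] is a Thom space, and every suspension
   coordinate completes the normal bundle of one section to a sum of [n_i + 1]
   copies of the line bundle; concretely, the fibres become products of balls
   with boundary collapsed, a point of which is given by chords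
   [(1 - t) *: b + t *: x] starting at the section [b]. *)

(** * Continuity *)

(** Maps out of a suspension can be added and subtracted by pasting loops, and the splitting is the
    identity [id = (id - e) + e] turned into explicit homotopies. A universal property up to
    homotopy suits this: its existence half is the map [phQ q + phA e], its uniqueness half is that
    identity, and it passes through the induction without naming any map into a wedge. Only at the
    end does uniqueness of coproducts compare the result with the wedge. Quotients are handled by
    formulas on representatives; this survives taking products with the interval because the
    interval is locally compact and Hausdorff. The indices come from the Thom space of [m] copies of
    the canonical line bundle over [RP^k], which is [RP^(k+m) / RP^(m-1)]: here [k = n ord0], and
    each [i] in [u] contributes [n_i + 1] copies. The desuspensions come with the construction:
    [Sigma Y_u] is itself a summand, and [#|u| - 1] further suspensions turn it into the stunted
    projective space. *)

Section continuity.
Context {T : topologicalType}.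

Lemma cts_comp {U V : topologicalType} (f : T -> U) (g : U -> V) :
  continuous g -> continuous f -> continuous (fun x => g (f x)).
Proof. by move=> cg cf x; apply: continuous_comp; [exact: cf|exact: cg]. Qed.

Lemma cts_eq {U : topologicalType} (f g : T -> U) :
  g =1 f -> continuous f -> continuous g.
Proof. by move=> /funext ->. Qed.

Lemma cts_pair {U V : topologicalType} (f : T -> U) (g : T -> V) :
  continuous f -> continuous g -> continuous (fun x => (f x, g x)).
Proof. by move=> cf cg x; apply: cvg_pair; [exact: cf|exact: cg]. Qed.

Lemma cts_fst {U V : topologicalType} (f : T -> U * V) :
  continuous f -> continuous (fun x => (f x).1).
Proof. by move=> cf; apply: cts_comp cf => x; exact: cvg_fst. Qed.

Lemma cts_snd {U V : topologicalType} (f : T -> U * V) :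
  continuous f -> continuous (fun x => (f x).2).
Proof. by move=> cf; apply: cts_comp cf => x; exact: cvg_snd. Qed.

Lemma cts_cst {U : topologicalType} (u : U) : continuous (fun _ : T => u).
Proof. by move=> x; exact: cvg_cst. Qed.

Lemma cts_id : continuous (fun x : T => x).
Proof. by move=> x; exact: cvg_id. Qed.

Lemma cts_proj {I : eqType} {K : I -> topologicalType}
    (f : T -> prod_topology K) i :
  continuous f -> continuous (fun x => f x i).
Proof. by move=> cf; exact: (@cts_comp (prod_topology K) (K i) f (proj i)
  (@proj_continuous _ K i) cf). Qed.

Lemma cts_prod {I : eqType} {K : I -> topologicalType}
    (f : T -> prod_topology K) :
  (forall i, continuous (fun x => f x i)) -> continuous f.
Proof.
move=> cf x; apply/cvg_sup => i A [_ /= [[C oC <-]]] /= Cx /filterS.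
apply; apply: cf; exact: open_nbhs_nbhs.
Qed.

Lemma cts_sub {U : topologicalType} (A : set U) (f : T -> set_type A) :
  continuous (fun x => \val (f x)) -> continuous f.
Proof. by move=> /continuous_comp_initial; apply. Qed.

Context {R : realType}.

Lemma ctsD (f g : T -> R) :
  continuous f -> continuous g -> continuous (fun x => f x + g x).
Proof. by move=> cf cg x; exact: (continuousD (cf x) (cg x)). Qed.

Lemma ctsN (f : T -> R) : continuous f -> continuous (fun x => - f x).
Proof. by move=> cf x; exact: (continuousN (cf x)). Qed.

Lemma ctsM (f g : T -> R) :
  continuous f -> continuous g -> continuous (fun x => f x * g x).
Proof. by move=> cf cg x; exact: (continuousM (cf x) (cg x)). Qed.

Lemma ctsX (f : T -> R) n : continuous f -> continuous (fun x => f x ^+ n).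
Proof.
move=> cf; elim: n => [|n IH]; first exact: cts_cst.
by under eq_fun do rewrite exprS; exact: ctsM.
Qed.

Lemma ctsV (f : T -> R) : (forall x, f x != 0) -> continuous f ->
  continuous (fun x => (f x)^-1).
Proof. by move=> f0 cf x; exact: (continuousV (f0 x) (cf x)). Qed.

Lemma cts_min (f g : T -> R) :
  continuous f -> continuous g -> continuous (fun x => Num.min (f x) (g x)).
Proof. by move=> cf cg x; exact: (continuous_min (cf x) (cg x)). Qed.

Lemma cts_max (f g : T -> R) :
  continuous f -> continuous g -> continuous (fun x => Num.max (f x) (g x)).
Proof. by move=> cf cg x; exact: (continuous_max (cf x) (cg x)). Qed.

Lemma cts_sqrt (f : T -> R) : continuous f ->
  continuous (fun x => Num.sqrt (f x)).
Proof. by apply: cts_comp; exact: sqrt_continuous. Qed.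

Lemma cts_big (op : R -> R -> R) (idx : R) (I : Type) (r : seq I) (P : pred I)
    (f : I -> T -> R) :
  (forall g h : T -> R, continuous g -> continuous h ->
    continuous (fun x => op (g x) (h x))) ->
  (forall i, P i -> continuous (f i)) ->
  continuous (fun x => \big[op/idx]_(i <- r | P i) f i x).
Proof.
move=> cop cf; elim: r => [|i r IH].
  apply: (@cts_eq _ (fun=> idx)); last exact: cts_cst.
  by move=> x; rewrite big_nil.
apply: (@cts_eq _ (fun x => if P i then op (f i x)
    (\big[op/idx]_(j <- r | P j) f j x) else \big[op/idx]_(j <- r | P j) f j
      x)).
  by move=> x; rewrite big_cons.
by case Pi : (P i) => //; apply: (cop) => //; exact: cf.
Qed.

Lemma cts_coord n (f : T -> 'rV[R]_n) j :
  continuous f -> continuous (fun x => f x ord0 j).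
Proof.
by move=> cf; exact: (@cts_comp _ R f _ (@coord_continuous R 1 n ord0 j) cf).
Qed.

Lemma cts_row n (f : T -> 'rV[R]_n) :
  (forall j, continuous (fun x => f x ord0 j)) -> continuous f.
Proof.
move=> cf x; apply/cvgrPdist_lt => e e0.
have : \forall y \near x, forall j, `|f x ord0 j - f y ord0 j| < e.
  apply: filter_forall => j; have /cvgrPdist_lt/(_ e e0) := cf j x; exact.
apply: filterS => y H; rewrite [`|_|]mx_normrE; apply/bigmax_ltP; split => //
  -[i j] _ /=.
by rewrite !mxE (ord1 i).
Qed.

(** Both branches are continuous everywhere, so pasting only needs agreement on the zero level of
    [m]. Concatenations of loops and of homotopies are continuous by this lemma. *)
Lemma cts_if {Z : topologicalType} (m : T -> R) (f g : T -> Z) :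
  continuous m -> continuous f -> continuous g ->
  (forall x, m x = 0 -> f x = g x) ->
  continuous (fun x => if m x <= 0 then f x else g x).
Proof.
move=> cm cf cg fg x; have [mx0|mx0|mx0] := ltgtP (m x) 0.
- rewrite /continuous_at (ltW mx0) => A /= Afx; have Ax : \forall y \near x, A
  (f y) := cf x A Afx.
  have : \forall y \near x, m y < 0.
    by apply: (cm x _ (open_nbhs_nbhs (conj (@open_lt R 0) _))).
  by move/(filterI Ax); apply: filterS => y /= [Ay my]; rewrite (ltW my).
- rewrite /continuous_at leNgt mx0 => A /= Agx; have Ax : \forall y \near x, A
  (g y) := cg x A Agx.
  have : \forall y \near x, 0 < m y.
    by apply: (cm x _ (open_nbhs_nbhs (conj (@open_gt R 0) _))).
  by move/(filterI Ax); apply: filterS => y /= [Ay my]; rewrite leNgt my.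
- rewrite /continuous_at mx0 lexx => A /= Afx; have Agx : nbhs (g x) A by
  rewrite -(fg x mx0).
  have Af : \forall y \near x, A (f y) := cf x A Afx.
  have Ag : \forall y \near x, A (g y) := cg x A Agx.
  suff: \forall y \near x, A (if m y <= 0 then f y else g y) by [].
  apply: filterS (filterI Af Ag) => y [Afy Agy].
  by case: (m y <= 0).
Qed.

End continuity.

Lemma continuous_fst (U V : topologicalType) : continuous (@fst U V).
Proof. by move=> x; exact: cvg_fst. Qed.

Lemma continuous_snd (U V : topologicalType) : continuous (@snd U V).
Proof. by move=> x; exact: cvg_snd. Qed.

(* Syntactic: unifying against arithmetic expressions would unfold the
   algebraic structures. *)
Ltac cts_with tac := repeat first [ assumption |
  lazymatch goal with |- forall y, continuous_at y ?F =>
    lazymatch F with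
    | (fun x => x) => exact: cts_id
    | fst => exact: continuous_fst
    | snd => exact: continuous_snd
    | (fun x => fst (@?a x)) => apply: (cts_fst (f := a))
    | (fun x => snd (@?a x)) => apply: (cts_snd (f := a))
    | (fun x => pair (@?a x) (@?b x)) => apply: (cts_pair (f := a) (g := b))
    | (fun x => (@?a x) + (@?b x)) => apply: (ctsD (f := a) (g := b))
    | (fun x => - (@?a x)) => apply: (ctsN (f := a))
    | (fun x => (@?a x) * (@?b x)) => apply: (ctsM (f := a) (g := b))
    | (fun x => (@?a x) ^+ ?n) => apply: (ctsX n (f := a))
    | (fun x => Num.min (@?a x) (@?b x)) => apply: (cts_min (f := a) (g := b))
    | (fun x => Num.max (@?a x) (@?b x)) => apply: (cts_max (f := a) (g := b))
    | _ => first [exact: cts_cst | exact: cts_id | tac F]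
    end
  end ].
Ltac cts_stop F := fail.
Ltac cts := cts_with cts_stop.

(** * Quotient maps and based homotopies *)

Section quotient_maps.

(** Stated by the mapping-out property rather than by open sets, since it serves to descend maps;
    stability under composition is then immediate. *)
Definition quotient_map (U V : topologicalType) (q : U -> V) : Prop :=
  [/\ continuous q, forall v, exists u, q u = v &
      forall (Z : topologicalType) (g : V -> Z),
        continuous (fun u => g (q u)) -> continuous g].

Lemma quotient_map_descend (U V Z : topologicalType) (q : U -> V) (F : U -> Z) :
  quotient_map q -> continuous F -> (forall x y, q x = q y -> F x = F y) ->
  exists2 f : V -> Z, continuous f & forall x, f (q x) = F x.
Proof.
move=> [cq sq uq] cF Fq; have [s qs] := choice sq.
have sF x : F (s (q x)) = F x by apply: Fq; rewrite qs.
exists (F \o s) => //; apply: uq; apply: cts_eq cF => x; exact: sF.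
Qed.

Lemma quotient_map_comp (U V W : topologicalType) (p : U -> V) (q : V -> W) :
  quotient_map p -> quotient_map q -> quotient_map (q \o p).
Proof.
move=> [cp sp up] [cq sq uq]; split; first exact: cts_comp.
  by move=> w; have [v <-] := sq w; have [u <-] := sp v; exists u.
by move=> Z g cg; apply: uq; exact: up.
Qed.

Lemma quotient_map_id (U : topologicalType) : quotient_map (@id U).
Proof. by split => // [|v]; [exact: cts_id | exists v]. Qed.

Lemma quotient_map_pi (T : topologicalType) (Q0 : quotType T) :
  quotient_map (\pi_(quotient_topology Q0) : T -> quotient_topology Q0).
Proof.
split; [exact: pi_continuous | by move=> v; exists (repr v); exact: reprK|].
by move=> Z g cg; apply/quotient_continuous.
Qed.

(* The exponential law for the compact-open topology. *)
Lemma continuous_sink_prod (I : Type) (U : I -> topologicalType)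
    (V W Z : topologicalType) (q : forall i, U i -> V) (g : V * W -> Z) :
  locally_compact [set: W] -> hausdorff_space W ->
  (forall v, exists i u, q i u = v) ->
  (forall (Z' : topologicalType) (h : V -> Z'),
    (forall i, continuous (fun u => h (q i u))) -> continuous h) ->
  (forall i, continuous (fun z : U i * W => g (q i z.1, z.2))) -> continuous g.
Proof.
move=> lcW hW sq uq cg.
(* The universal property applies to [curry g], a map out of [V] alone into a mapping space;
   uncurrying again is where the conditions on [W] enter. *)
have -> : g = uncurry (curry g) by apply/funext => -[].
have H i := continuous_curry (cg i).
apply: continuous_uncurry => //.
  by apply: (uq {compact-open, W -> Z} (curry g)) => i; have [] := H i.
by move=> v; have [i [u <-]] := sq v; have [_] := H i; exact.
Qed.

Lemma quotient_map_prod (U V W : topologicalType) (q : U -> V) :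
  locally_compact [set: W] -> hausdorff_space W -> quotient_map q ->
  quotient_map (fun z : U * W => (q z.1, z.2)).
Proof.
move=> lcW hW [cq sq uq]; split.
- by cts; apply: cts_comp cq _; cts.
- by move=> [v w]; have [u <-] := sq v; exists (u, w).
- move=> Z g cg.
  apply: (@continuous_sink_prod unit (fun=> U) V W Z (fun=> q)) => //.
  by move=> Z' h ch; apply: uq; exact: (ch tt).
Qed.

End quotient_maps.

(** * The unit interval as a retract of the line *)

Section unit_interval.
Context {R : realType}.
Local Notation I := (unit_interval R).

Lemma clip_proof (r : R) :
  Num.max 0 (Num.min 1 r) \in (`[0, 1]%classic : set R).
Proof.
by rewrite mem_setE in_itv /= le_max lexx ge_max ler01 ge_min lexx.
Qed.

(** Through this retraction of the line onto the interval, loops and homotopies can be written with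
    real parameters such as [2 * r - 1], free of membership proofs. *)
Definition clip (r : R) : I := SigSub (clip_proof r).
Arguments clip : simpl never.

Lemma unit_ge0 (t : I) : 0 <= \val t.
Proof. by have /set_mem := valP t; rewrite /= in_itv /= => /andP[]. Qed.

Lemma unit_le1 (t : I) : \val t <= 1.
Proof. by have /set_mem := valP t; rewrite /= in_itv /= => /andP[]. Qed.

Lemma clipK (t : I) : clip (\val t) = t.
Proof.
by apply: val_inj; rewrite /clip /=; rewrite (min_idPr (unit_le1 t)) (max_idPr
  (unit_ge0 t)).
Qed.

Lemma val_clip r : 0 <= r -> r <= 1 -> \val (clip r) = r.
Proof. by move=> r0 r1; rewrite /clip /= (min_idPr r1) (max_idPr r0). Qed.

Lemma clip_le0 r : r <= 0 -> clip r = I0 R.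
Proof.
move=> r0; apply: val_inj => /=.
by rewrite (min_idPr (le_trans r0 ler01)) (max_idPl r0).
Qed.

Lemma clip_ge1 r : 1 <= r -> clip r = I1 R.
Proof.
by move=> r1; apply: val_inj; rewrite /clip /=; rewrite (min_idPl r1) (max_idPr
  ler01).
Qed.

Lemma cts_uval (T : topologicalType) (f : T -> I) : continuous f ->
  continuous (fun x => \val (f x) : R).
Proof. by apply: cts_comp; exact: initial_continuous. Qed.

Lemma cts_clip (T : topologicalType) (f : T -> R) : continuous f ->
  continuous (fun x => clip (f x)).
Proof. by move=> cf; apply: cts_sub; rewrite /clip /=; cts. Qed.

Lemma unit_interval_compact : compact [set: I].
Proof.
have -> : [set: I] = clip @` `[0, 1]%classic.
  rewrite eqEsubset; split => t // _; exists (\val t); last exact: clipK.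
  by rewrite /= in_itv /= unit_ge0 unit_le1.
apply: continuous_compact; last exact: segment_compact.
by apply: continuous_subspaceT; apply: cts_clip; cts.
Qed.

Lemma hausdorff_inj (T U : topologicalType) (f : T -> U) :
  hausdorff_space U -> continuous f -> injective f -> hausdorff_space T.
Proof.
move=> hU cf injf x y xy; apply: injf; apply: hU => A B Ax By.
by have [z [Az Bz]] := xy _ _ (cf _ _ Ax) (cf _ _ By); exists (f z).
Qed.

Lemma unit_interval_hausdorff : hausdorff_space I.
Proof.
apply: (@hausdorff_inj (unit_interval R) R (fun x : I => \val x : R)).
  exact: Rhausdorff.
  by apply: cts_uval; cts.
exact: val_inj.
Qed.

Lemma unit_interval_lc : locally_compact [set: I].
Proof.
move=> x _; exists setT; first by apply: nearW.
by split; [exact: unit_interval_compact | exact: closedT].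
Qed.

Lemma quotient_map_unit (U V : topologicalType) (q : U -> V) :
  quotient_map q -> quotient_map (fun z : U * I => (q z.1, z.2)).
Proof.
by apply: quotient_map_prod; [exact: unit_interval_lc|
  exact: unit_interval_hausdorff].
Qed.

End unit_interval.
Arguments clip : simpl never.

Ltac cts_unit F :=
  lazymatch F with
  | (fun x => clip (@?a x)) => apply: (cts_clip (f := a))
  | _ => apply: cts_uval
  end.
Ltac ctsu := cts_with cts_unit.

(** * Based homotopies *)

Section based.
Context {R : realType}.
Implicit Types X Y Z : ptopologicalType.
Local Notation I := (unit_interval R).
Local Notation "f ~~ g" := (based_homotopic R f g) (at level 70).
Local Notation Sigma := (reduced_suspension R).

Definition based_map X Y (f : X -> Y) := continuous f /\ f point = point.

Lemma bh_ends X Y (f g : X -> Y) (K : X * R -> Y) :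
  continuous K -> (forall x, K (x, 0) = f x) -> (forall x, K (x, 1) = g x) ->
  (forall r, K (point, r) = point) -> f ~~ g.
Proof.
move=> cK K0 K1 Kp; exists (fun z => K (z.1, \val z.2)); split => //=.
by apply: cts_comp cK _; ctsu.
Qed.

(** Extending a homotopy by constants to all real times lets concatenations be pasted without range
    conditions. *)
Lemma bh_real X Y (f g : X -> Y) : f ~~ g ->
  exists K : X * R -> Y,
    [/\ continuous K, forall x r, r <= 0 -> K (x, r) = f x,
        forall x r, 1 <= r -> K (x, r) = g x & forall r, K (point, r) = point].
Proof.
case=> h [ch h0 h1 hp]; exists (fun z => h (z.1, clip z.2)); split => //=.
- by apply: cts_comp ch _; ctsu.
- by move=> x r r0; rewrite clip_le0.
- by move=> x r r1; rewrite clip_ge1.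
Qed.

Lemma bh_refl X Y (f : X -> Y) : based_map f -> f ~~ f.
Proof.
case=> cf fp; apply: (@bh_ends _ _ _ _ (fun z => f z.1)) => //.
by apply: cts_comp cf _; cts.
Qed.

Lemma bh_sym X Y (f g : X -> Y) : f ~~ g -> g ~~ f.
Proof.
case/bh_real => K [cK K0 K1 Kp].
apply: (@bh_ends _ _ _ _ (fun z => K (z.1, 1 - z.2))) => [|x|x|r] /=.
- by apply: cts_comp cK _; cts.
- by rewrite K1 // subr0.
- by rewrite K0 // subrr.
- exact: Kp.
Qed.

Lemma bh_trans X Y (f g h : X -> Y) : f ~~ g -> g ~~ h -> f ~~ h.
Proof.
move=> /bh_real[K [cK K0 K1 Kp]] /bh_real[L [cL L0 L1 Lp]].
apply: (@bh_ends _ _ _ _ (fun z => if 2 * z.2 - 1 <= 0 then K (z.1, 2 * z.2)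
                                  else L (z.1, 2 * z.2 - 1))) => [|x|x|r] /=.
- apply: cts_if; cts; [by apply: cts_comp cK _; cts|
    by apply: cts_comp cL _; cts|].
  by move=> [x r] /= r1; rewrite r1 L0 // K1 //; lra.
- by rewrite ifT ?K0 //; lra.
- by rewrite ifF ?L1 //; [lra | apply/negbTE; rewrite -ltNge; lra].
- by rewrite Kp Lp; case: ifP.
Qed.

Lemma bh_compl X Y Z (f : Y -> Z) (g g' : X -> Y) :
  based_map f -> g ~~ g' -> f \o g ~~ f \o g'.
Proof.
move=> [cf fp] [h [ch h0 h1 hp]]; exists (f \o h); split => /=.
- exact: cts_comp.
- by move=> x; rewrite h0.
- by move=> x; rewrite h1.
- by move=> t; rewrite hp.
Qed.

Lemma bh_compr X Y Z (f f' : Y -> Z) (g : X -> Y) :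
  based_map g -> f ~~ f' -> f \o g ~~ f' \o g.
Proof.
move=> [cg gp] [h [ch h0 h1 hp]]; exists (fun z => h (g z.1, z.2)); split => /=.
- by apply: cts_comp ch _; apply: cts_pair; cts; apply: cts_comp cg _; cts.
- by move=> x; rewrite h0.
- by move=> x; rewrite h1.
- by move=> t; rewrite gp hp.
Qed.

Lemma based_map_comp X Y Z (f : Y -> Z) (g : X -> Y) :
  based_map f -> based_map g -> based_map (f \o g).
Proof. by move=> [cf fp] [cg gp]; split; [exact: cts_comp | rewrite /= gp]. Qed.

Lemma based_map_id X : based_map (@id X).
Proof. by split => //; exact: cts_id. Qed.

End based.

(** * Suspensions *)

Section suspension.
Context {R : realType}.
Implicit Types X Y Z : ptopologicalType.
Local Notation I := (unit_interval R).
Local Notation "f ~~ g" := (based_homotopic R f g) (at level 70).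
Local Notation Sigma := (reduced_suspension R).

Lemma collapse_eq (T : ptopologicalType) (A : set T) (x y : T) :
  (\pi_(collapse A) x = \pi_(collapse A) y) <-> (x = y \/ A x /\ A y).
Proof.
split=> [/eqmodP/orP[/eqP ->|/andP[/set_mem xA /set_mem yA]]|[->//|[xA yA]]].
- by left.
- by right.
- by apply/eqmodP/orP; right; rewrite !mem_set.
Qed.

(** The height is any real number, clipped, so that heights outside (0, 1) give the base point and
    reparametrized formulas are total. *)
Definition susp X (x : X) (r : R) : Sigma X :=
  \pi_(Sigma X) ((x, clip r) : X * I).

Lemma susp_le0 X (x : X) r : r <= 0 -> susp x r = point.
Proof.
move=> r0; apply/collapse_eq; right; rewrite /= clip_le0 //.
by split; [exact: Or32 | exact: Or31].
Qed.

Lemma susp_ge1 X (x : X) r : 1 <= r -> susp x r = point.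
Proof.
move=> r1; apply/collapse_eq; right; rewrite /= clip_ge1 //.
by split; [exact: Or33 | exact: Or31].
Qed.

Lemma susp_pt X r : susp (point : X) r = point.
Proof. by apply/collapse_eq; right; split; exact: Or31. Qed.

Lemma cts_susp (T : topologicalType) X (f : T -> X) (g : T -> R) :
  continuous f -> continuous g -> continuous (fun z => susp (f z) (g z)).
Proof.
move=> cf cg; apply: (@cts_comp _ (X * I)%type _ (fun z => (f z, clip (g z)))).
  exact: pi_continuous.
by ctsu.
Qed.

Definition susp_quot (T : topologicalType) X (q : T -> X) (z : T * I) :
  Sigma X := \pi_(Sigma X) ((q z.1, z.2) : X * I).

Lemma susp_quotE (T : topologicalType) X (q : T -> X) z :
  susp_quot q z = susp (q z.1) (\val z.2).
Proof. by rewrite /susp clipK. Qed.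

Lemma quotient_map_susp (T : topologicalType) X (q : T -> X) :
  quotient_map q -> quotient_map (susp_quot q).
Proof.
move=> qq; apply: (quotient_map_comp (quotient_map_unit qq)).
exact: quotient_map_pi.
Qed.

(** Descends a formula on representatives in [T]. At heights outside [0, 1] the values of [F] are
    arbitrary, hence the range conditions in the conclusion. *)
Lemma susp_lift (T : topologicalType) X Z (q : T -> X) (F : T * R -> Z) :
  quotient_map q -> continuous F ->
  (forall x y r, q x = q y -> F (x, r) = F (y, r)) ->
  (forall x, F (x, 0) = point) -> (forall x, F (x, 1) = point) ->
  (forall x r, q x = point -> F (x, r) = point) ->
  exists2 f : Sigma X -> Z, based_map f &
    forall x r, 0 <= r -> r <= 1 -> f (susp (q x) r) = F (x, r).
Proof.
move=> qq cF Fq F0 F1 Fp.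
have cF' : continuous (fun z : T * I => F (z.1, \val z.2)).
  by apply: cts_comp cF _; ctsu.
have [|f cf fE] := quotient_map_descend (quotient_map_susp qq) cF' (Z := Z).
  move=> [x s] [y t] /collapse_eq[/= [xy ->]|/= [xs yt]]; first exact: Fq.
  have P u (v : I) : [\/ q u = point, v = I0 R | v = I1 R] ->
      F (u, \val v) = point.
    by case=> [/Fp ->//|->|->] /=.
  by rewrite !P.
have fS x r : 0 <= r -> r <= 1 -> f (susp (q x) r) = F (x, r).
  move=> r0 r1; rewrite -(val_clip r0 r1).
  by have := fE (x, clip r); rewrite susp_quotE.
exists f => //; split => //.
have [_ sq _] := qq; have [x xp] := sq point.
by rewrite -(susp_le0 point (lexx 0)) -xp fS.
Qed.

(** [Sigma X * I] is a quotient of [(T * I) * I], so a homotopy may also be given on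
    representatives. *)
Lemma susp_homotopy (T : topologicalType) X Z (q : T -> X) (f g : Sigma X -> Z)
    (K : T * R * R -> Z) :
  quotient_map q -> continuous K ->
  (forall x r, 0 <= r -> r <= 1 -> K (x, r, 0) = f (susp (q x) r)) ->
  (forall x r, 0 <= r -> r <= 1 -> K (x, r, 1) = g (susp (q x) r)) ->
  (forall x s, 0 <= s -> s <= 1 -> K (x, 0, s) = point) ->
  (forall x s, 0 <= s -> s <= 1 -> K (x, 1, s) = point) ->
  (forall x y r s, 0 <= r -> r <= 1 -> 0 <= s -> s <= 1 -> q x = q y ->
     K (x, r, s) = K (y, r, s)) ->
  (forall x r s, 0 <= r -> r <= 1 -> 0 <= s -> s <= 1 -> q x = point ->
     K (x, r, s) = point) ->
  f ~~ g.
Proof.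
move=> qq cK K0 K1 Kb0 Kb1 Kq Kp.
have cK' : continuous (fun z : T * I * I => K (z.1.1, \val z.1.2, \val z.2)).
  by apply: cts_comp cK _; ctsu.
have [|h ch hE] := quotient_map_descend
    (quotient_map_unit (quotient_map_susp qq)) cK' (Z := Z).
  move=> [[x r] s] [[y r'] s'] /= [/collapse_eq H <-].
  case: H => [/= [xy ->]|/= [xs yt]].
    by apply: Kq; rewrite ?unit_ge0 ?unit_le1.
  have P u (v : I) : [\/ q u = point, v = I0 R | v = I1 R] ->
      K (u, \val v, \val s) = point.
    case=> [/Kp ->//|->|->] /=; rewrite ?unit_ge0 ?unit_le1 //.
      by rewrite Kb0 ?unit_ge0 ?unit_le1.
    by rewrite Kb1 ?unit_ge0 ?unit_le1.
  by rewrite !P.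
have [_ sS _] := quotient_map_susp qq.
exists h; split => //.
- move=> v; have [z <-] := sS v; rewrite (hE (z, I0 R)) /= susp_quotE.
  by rewrite K0 ?unit_ge0 ?unit_le1.
- move=> v; have [z <-] := sS v; rewrite (hE (z, I1 R)) /= susp_quotE.
  by rewrite K1 ?unit_ge0 ?unit_le1.
- move=> t; have [_ sq _] := qq; have [x xp] := sq point.
  rewrite -(susp_le0 point (lexx 0)) -xp.
  rewrite -(val_clip (lexx 0) ler01).
  have := hE ((x, clip 0), t); rewrite susp_quotE => ->; rewrite val_clip //=.
  by rewrite Kb0 ?unit_ge0 ?unit_le1.
Qed.

Lemma susp_surj X (v : Sigma X) :
  exists x r, [/\ 0 <= r, r <= 1 & v = susp x r].
Proof.
have [_ sS _] := quotient_map_susp (quotient_map_id X).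
have [z <-] := sS v; exists z.1, (\val z.2).
by rewrite unit_ge0 unit_le1 susp_quotE.
Qed.

Lemma susp_map X Y (f : X -> Y) : based_map f ->
  exists2 g : Sigma X -> Sigma Y, based_map g &
    forall x r, g (susp x r) = susp (f x) r.
Proof.
move=> [cf fp].
have [|||||g bg gE] := @susp_lift X X (Sigma Y) id
  (fun z => susp (f z.1) z.2) (quotient_map_id X).
- by apply: cts_susp; cts; apply: cts_comp cf _; cts.
- by move=> x y r /= ->.
- by move=> x; rewrite susp_le0.
- by move=> x; rewrite susp_ge1.
- by move=> x r /= ->; rewrite fp susp_pt.
exists g => // x r; have [r0|r0] := leP r 0.
  by rewrite !susp_le0 //; case: bg.
have [r1|r1] := leP 1 r; first by rewrite !susp_ge1 //; case: bg.
by rewrite gE // ltW.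
Qed.

End suspension.

(** * Splitting off a retract *)

Section split.
Context {R : realType}.
Local Notation I := (unit_interval R).
Local Notation "f ~~ g" := (based_homotopic R f g) (at level 70).
Local Notation Sigma := (reduced_suspension R).
Context (Y A Q : ptopologicalType) (s : A -> Y) (e : Y -> A) (q : Y -> Q).
Context (bs : based_map s) (be : based_map e) (es : cancel s e).
Context (qq : quotient_map q).
Context (qE : forall x y, q x = q y -> x = y \/ range s x /\ range s y).
Context (qs : forall a, q (s a) = point).
(** [H] and [l] make the image of [s] a neighbourhood deformation retract: [H] keeps this image
    inside itself, possibly moving its points, and at time 1 carries the neighbourhood [l < 1] into
    it. *)
Context (H : Y * R -> Y) (cH : continuous H) (H0 : forall y, H (y, 0) = y).
Context (Hp : forall r, H (point, r) = point).
Context (Hs : forall a r, range s (H (s a, r))).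
Context (l : Y -> R) (cl : continuous l).
Context (l0 : forall y, 0 <= l y) (l1 : forall y, l y <= 1).
Context (ls : forall a, l (s a) = 0).
Context (lH : forall y, l y < 1 -> range s (H (y, 1))).

Let cs : continuous s. Proof. by case: bs. Qed.
Let sp : s point = point. Proof. by case: bs. Qed.
Let ce : continuous e. Proof. by case: be. Qed.
Let ep : e point = point. Proof. by case: be. Qed.
Let cq : continuous q. Proof. by case: qq. Qed.
Let qp : q point = point. Proof. by rewrite -{1}sp qs. Qed.
Let seK y : range s y -> s (e y) = y. Proof. by case=> a _ <-; rewrite es. Qed.
Let q_range y : range s y -> q y = point. Proof. by case=> a _ <-. Qed.
Let q_ptE y : q y = point -> range s y.
Proof.
by rewrite -(qs point) => /qE[->|[]//]; exists point.
Qed.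
Let Hrange y r : range s y -> range s (H (y, r)).
Proof. by case=> a _ <-. Qed.
Let lrange y : range s y -> l y = 0. Proof. by case=> a _ <-. Qed.
Let l_eq1 y : ~ l y < 1 -> l y = 1.
Proof. by move/negP; rewrite -leNgt => ?; apply/le_anti/andP. Qed.

Ltac cts_split F :=
  lazymatch F with
  | (fun x => s (@?a x)) => apply: (cts_comp (f := a) cs)
  | (fun x => e (@?a x)) => apply: (cts_comp (f := a) ce)
  | (fun x => q (@?a x)) => apply: (cts_comp (f := a) cq)
  | (fun x => l (@?a x)) => apply: (cts_comp (f := a) cl)
  | (fun x => H (@?a x)) => apply: (cts_comp (f := a) cH)
  | (fun x => susp (@?a x) (@?b x)) => apply: (cts_susp (f := a) (g := b))
  | (fun x => if _ <= 0 then _ else _) => apply: cts_if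
  end.
Ltac ctss := cts_with cts_split.

(* Out along [H (y, 1)] up to level [l y], and back down along its retract. *)
Let psi (z : Y * R) : Sigma Y :=
  if 2 * z.2 - 1 <= 0 then susp (H (z.1, 1)) (2 * z.2 * l z.1)
  else susp (s (e (H (z.1, 1)))) ((2 - 2 * z.2) * l z.1).

Let psi_range y r : range s y -> psi (y, r) = point.
Proof.
by move=> /lrange ly; rewrite /psi /= ly !mulr0 !susp_le0 //; case: (_ <= _).
Qed.

Let psi_cts : continuous psi.
Proof.
rewrite /psi; ctss => -[y r] /= r0.
have -> : 2 * r = 1 by lra.
have -> : (2 - 1) * l y = 1 * l y by ring.
(* The turning point has height [l y]. If this is below 1, [H (y, 1)] lies in the image of [s] and
   equals its own retract; if it is 1, both branches are at the base point. *)
have [/lH/seK -> //|/negP ly] := boolP (l y < 1).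
by rewrite (l_eq1 ly) !susp_ge1 ?mulr1.
Qed.

Lemma split_maps : exists (iA : Sigma A -> Sigma Y) (iQ : Sigma Q -> Sigma Y),
  [/\ based_map iA, based_map iQ, forall a r, iA (susp a r) = susp (s a) r &
      forall y r, 0 <= r -> r <= 1 -> iQ (susp (q y) r) = psi (y, r)].
Proof.
have [iA biA iAE] := susp_map (R := R) bs.
have [||||iQ biQ iQE] := susp_lift qq psi_cts; last by exists iA, iQ.
- move=> x y r /qE[->//|[xs ys]]; by rewrite !psi_range.
- move=> y; rewrite /psi /= ifT; last lra.
  by rewrite susp_le0 // mulr0 mul0r.
- move=> y; rewrite /psi /= ifF; last by apply/negbTE; rewrite -ltNge; lra.
  by rewrite susp_le0 // mulr1 subrr mul0r.
- by move=> y r /q_ptE; exact: psi_range.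
Qed.

Context (iA : Sigma A -> Sigma Y) (iQ : Sigma Q -> Sigma Y).
Context (biA : based_map iA) (biQ : based_map iQ).
Context (iAE : forall a r, iA (susp a r) = susp (s a) r).
Context (iQE : forall y r, 0 <= r -> r <= 1 -> iQ (susp (q y) r) = psi (y, r)).

(** [Phi] is the sum [phQ q + phA e]. On [iA] the first term is constant, as [q s] is. On [iQ] the
    way out gives [phQ q + phA e] and the way back, in reverse order, [- phA e] followed by a
    constant; with this order of the summands the two [phA] terms are adjacent and cancel. *)
Lemma split_extension (Z : ptopologicalType) (phA : Sigma A -> Z) (phQ : Sigma Q
  -> Z) :
  based_map phA -> based_map phQ ->
  exists Phi : Sigma Y -> Z, [/\ based_map Phi, Phi \o iA ~~ phA & Phi \o iQ ~~
    phQ].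
Proof.
move=> bA bQ; have [cA pA] := bA; have [cQ pQ] := bQ.
pose F (z : Y * R) := if 2 * z.2 - 1 <= 0 then phQ (susp (q z.1) (2 * z.2))
                      else phA (susp (e z.1) (2 * z.2 - 1)).
have cF : continuous F.
  apply: cts_if; [by ctss|by apply: cts_comp cQ _; ctss|
    by apply: cts_comp cA _; ctss|].
  move=> [y r] /= r1; rewrite r1 [in RHS]susp_le0 // susp_ge1 ?pA ?pQ //; lra.
have [||||Phi bPhi PhiE] := susp_lift (quotient_map_id Y) cF.
- by move=> x y r /= ->.
- by move=> y; rewrite /F /= ifT ?susp_le0 //; lra.
- move=> y; rewrite /F /= ifF ?susp_ge1 //; first lra.
  by apply/negbTE; rewrite -ltNge; lra.
- move=> x r /= ->; rewrite /F /= qp ep !susp_pt pA pQ; by case: (_ <= _).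
exists Phi; split => //.
- apply: (@susp_homotopy _ _ _ _ id _ _
    (fun z => phA (susp z.1.1 ((1 - z.2) * (2 * z.1.2 - 1) + z.2 * z.1.2)))).
  + exact: quotient_map_id.
  + by apply: cts_comp cA _; ctss.
  + move=> a r r0 r1 /=; rewrite iAE PhiE // /F /= qs es susp_pt pQ.
    rewrite subr0 mul1r mul0r addr0.
    case: (leP (2 * r - 1) 0) => [r2|//].
    by rewrite susp_le0.
  + by move=> a r r0 r1 /=; rewrite subrr mul0r mul1r add0r.
  + by move=> a t t0 t1 /=; rewrite susp_le0 //; lra.
  + by move=> a t t0 t1 /=; rewrite susp_ge1 //; lra.
  + by move=> x y r t _ _ _ _ /= ->.
  + by move=> x r t _ _ _ _ /= ->; rewrite susp_pt.
pose G (z : Y * R) := phQ (susp (q (H (z.1, 1))) (4 * z.2)).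
pose u1 (z : Y * R) : R := 2 * z.2 * l z.1.
pose u2 (z : Y * R) : R := (2 - 2 * z.2) * l z.1.
(* [K1] cancels the two traversals of [phA], cut off at the level [z.2]; [K2]
   undoes [H (_, 1)] and reparametrizes what is left of [phQ]. *)
pose K1 (z : Y * R * R) :=
  if 2 * z.1.2 - 1 <= 0 then
    if 2 * u1 z.1 - 1 <= 0 then phQ (susp (q (H (z.1.1, 1))) (2 * u1 z.1))
    else phA (susp (e (H (z.1.1, 1))) ((2 * u1 z.1 - 1) * Num.max 0 z.2))
  else phA (susp (e (H (z.1.1, 1))) ((2 * u2 z.1 - 1) * Num.max 0 z.2)).
have cG : continuous G by apply: cts_comp cQ _; ctss.
have K1range y r t : range s y -> K1 (y, r, t) = point.
  move=> ys; have ly := lrange ys.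
  rewrite /K1 /= /u1 /u2 /= ly !mulr0 sub0r lerN10 susp_le0 // susp_le0.
    by rewrite pA pQ; case: (_ <= _).
  by rewrite mulN1r oppr_le0 le_max lexx.
have cK1 : continuous K1.
  have cu1 : continuous u1 by rewrite /u1; ctss.
  have cu2 : continuous u2 by rewrite /u2; ctss.
  apply: cts_if; [by ctss| |by apply: cts_comp cA _; ctss; apply: cts_comp cu2
    _; ctss|].
    apply: cts_if; [by ctss; apply: cts_comp cu1 _; ctss |
      by apply: cts_comp cQ _; ctss; apply: cts_comp cu1 _; ctss |
      by apply: cts_comp cA _; ctss; apply: cts_comp cu1 _; ctss |].
    move=> [[y r] t] /= ru; rewrite ru mul0r [in RHS]susp_le0 // susp_ge1 ?pA
      ?pQ //; lra.
  move=> [[y r] t] /= r2; rewrite /u1 /u2 /=.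
  have -> : 2 * r = 1 by lra.
  have -> : (2 - 1) * l y = 1 * l y by ring.
  case: (leP (2 * (1 * l y) - 1) 0) => // ly; rewrite [in RHS]susp_le0; last
    first.
    by rewrite mulr_le0_ge0 // le_max lexx.
  rewrite q_range ?susp_pt ?pA ?pQ //; apply: lH; lra.
pose K2 (z : Y * R * R) :=
  phQ (susp (q (H (z.1.1, 1 - z.2))) ((1 - z.2) * (4 * z.1.2) + z.2 * z.1.2)).
have cK2 : continuous K2 by apply: cts_comp cQ _; ctss.
have K2range y r t : range s y -> K2 (y, r, t) = point.
  by move=> ys; rewrite /K2 /= q_range ?susp_pt ?pQ //; exact: Hrange.
have K12 y r : K1 (y, r, 0) = K2 (y, r, 0).
  rewrite /K1 /K2 /u1 /u2 /= subr0 mul1r mul0r addr0 maxxx !mulr0.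
  rewrite [susp (e _) 0]susp_le0 // pA.
  (* Below level 1, [q] sends [H (y, 1)] to the base point and both sides are constant; at level 1
     the factor [l y] disappears. The speed 4 arises because the way out takes half of the loop and
     [phQ] half of [Phi]. *)
  have [/lH/q_range ->|/negP ly] := boolP (l y < 1).
    by rewrite !susp_pt pQ !if_same.
  rewrite (l_eq1 ly) mulr1.
  case: (leP (2 * r - 1) 0) => r2; last by rewrite susp_ge1 ?pQ //; lra.
  case: (leP (2 * (2 * r) - 1) 0) => r4; last by rewrite susp_ge1 ?pQ //; lra.
  by congr (phQ (susp _ _)); ring.
apply: (@susp_homotopy _ _ _ _ q _ _ (fun z => if 2 * z.2 - 1 <= 0
  then K1 (z.1.1, z.1.2, 1 - 2 * z.2) else K2 (z.1.1, z.1.2, 2 * z.2 - 1))) =>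
    //.
- apply: cts_if; [by ctss|by apply: cts_comp cK1 _; ctss|
    by apply: cts_comp cK2 _; ctss|].
  move=> [[y r] t] /= t2; rewrite t2.
  have -> : 1 - 2 * t = 0 by lra.
  exact: K12.
- move=> y r r0 r1 /=; rewrite ifT ?mulr0 ?subr0; last lra.
  rewrite iQE // /psi /K1 /= (max_idPr ler01) !mulr1 -/(u1 (y, r)) -/(u2 (y,
    r)).
  have u10 : 0 <= u1 (y, r) by rewrite /u1 /=; do 2?apply: mulr_ge0 => //; lra.
  case: (leP (2 * r - 1) 0) => r2.
    have u11 : u1 (y, r) <= 1.
      by rewrite /u1 /= -[leRHS]mulr1; apply: ler_pM => //; lra.
    by rewrite PhiE.
  have u20 : 0 <= u2 (y, r) by rewrite /u2 /=; apply: mulr_ge0 => //; lra.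
  have u21 : u2 (y, r) <= 1.
    by rewrite /u2 /= -[leRHS]mulr1; apply: ler_pM => //; lra.
  rewrite PhiE // /F /= qs es susp_pt pQ.
  by case: (leP (2 * u2 (y, r) - 1) 0) => // u2'; rewrite susp_le0.
- move=> y r r0 r1 /=; rewrite ifF; last by apply/negbTE; rewrite -ltNge; lra.
  rewrite /K2 /=; have -> : (2 * 1 - 1 : R) = 1 by lra.
  by rewrite subrr H0 mul0r mul1r add0r.
- move=> y t t0 t1 /=; case: (leP (2 * t - 1) 0) => t2.
    rewrite /K1 /= /u1 /= ifT; last lra.
    by rewrite !mulr0 mul0r mulr0 ifT ?susp_le0 ?pQ //; lra.
  by rewrite /K2 /= !mulr0 addr0 susp_le0.
- move=> y t t0 t1 /=; case: (leP (2 * t - 1) 0) => t2.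
    rewrite /K1 /= /u2 /= ifF; last by apply/negbTE; rewrite -ltNge; lra.
    by rewrite mulr1 subrr mul0r mulr0 sub0r mulN1r susp_le0 ?pA // oppr_le0
      le_max lexx.
  rewrite /K2 /= susp_ge1 ?pQ //; lra.
- move=> x y r t _ _ _ _ /= /qE[->//|[xs ys]].
  by rewrite !K1range // !K2range.
- move=> x r t _ _ _ _ /= /q_ptE xs; rewrite K1range // K2range //.
  by case: (_ <= _).
Qed.

(** The map [m] is [iQ q + iA e], that is [(id - e) + e], hence homotopic to the identity. So [f] is
    homotopic to [f iQ q + f iA e], where the given homotopies can be inserted termwise. *)
Lemma split_uniqueness (Z : ptopologicalType) (f g : Sigma Y -> Z) :
  based_map f -> based_map g -> f \o iA ~~ g \o iA -> f \o iQ ~~ g \o iQ ->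
  f ~~ g.
Proof.
pose M (z : Y * R) : Sigma Y := if 2 * z.2 - 1 <= 0
  then iQ (susp (q z.1) (2 * z.2)) else iA (susp (e z.1) (2 * z.2 - 1)).
have [ciA iAp] := biA; have [ciQ iQp] := biQ.
have cM : continuous M.
  apply: cts_if; [by ctss|by apply: cts_comp ciQ _; ctss|
    by apply: cts_comp ciA _; ctss|].
  move=> [y r] /= r2; rewrite r2 [in RHS]susp_le0 // iAp susp_ge1 ?iQp //; lra.
have [||||m bm mE] := susp_lift (quotient_map_id Y) cM.
- by move=> x y r /= ->.
- by move=> y; rewrite /M /= ifT ?susp_le0 //; lra.
- move=> y; rewrite /M /= ifF ?susp_ge1 //; first lra.
  by apply/negbTE; rewrite -ltNge; lra.
- move=> x r /= ->; rewrite /M /= qp ep !susp_pt iAp iQp; by case: (_ <= _).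
have idm : m ~~ id.
  pose la (z : Y * R * R) := l z.1.1 + z.2 * (1 - l z.1.1).
  have cla : continuous la by rewrite /la; ctss.
  (* Raising the level keeps the branches glued at the turning point: a height below 1 still puts
     [H (y, 1)] in the image of [s]. *)
  have la1 y r t : la (y, r, t) < 1 -> l y < 1.
    rewrite /la /= => h; rewrite lt_neqAle l1 andbT; apply: contraTN h => /eqP
      ->.
    by rewrite subrr mulr0 addr0 ltxx.
  (* [K1] raises the level [l] to 1, [N] undoes [H (_, 1)], [L] cancels the way
     back along [s (e y)] against the last half of the loop, [S] reparametrizes. *)
  pose K1 (z : Y * R * R) := if 2 * z.1.2 - 1 <= 0 then
    if 4 * z.1.2 - 1 <= 0 then susp (H (z.1.1, 1)) (4 * z.1.2 * la z)
    else susp (s (e (H (z.1.1, 1)))) ((2 - 4 * z.1.2) * la z)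
    else susp (s (e z.1.1)) (2 * z.1.2 - 1).
  have cK1 : continuous K1.
    apply: cts_if; [by ctss| |by ctss|].
      apply: cts_if; [by ctss|by ctss|by ctss|].
      move=> [[y r] t] /= r4.
      have -> : 4 * r = 1 by lra.
      have -> : (2 - 1) * la (y, r, t) = 1 * la (y, r, t) by ring.
      case: (ltP (la (y, r, t)) 1) => [/la1/lH/seK -> //|h].
      by rewrite !susp_ge1 ?mul1r.
    move=> [[y r] t] /= r2; rewrite r2 ifF; last first.
      by apply/negbTE; rewrite -ltNge; lra.
    have -> : 2 - 4 * r = 0 by lra.
    by rewrite mul0r !susp_le0.
  pose N (z : Y * R * R) := if 2 * z.1.2 - 1 <= 0 then
    if 4 * z.1.2 - 1 <= 0 then susp (H (z.1.1, 1 - z.2)) (4 * z.1.2)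
    else susp (s (e (H (z.1.1, 1 - z.2)))) (2 - 4 * z.1.2)
    else susp (s (e z.1.1)) (2 * z.1.2 - 1).
  have cN : continuous N.
    apply: cts_if; [by ctss| |by ctss|].
      apply: cts_if; [by ctss|by ctss|by ctss|].
      by move=> [[y r] t] /= r4; rewrite !susp_ge1 //; lra.
    move=> [[y r] t] /= r2; rewrite r2 ifF; last first.
      by apply/negbTE; rewrite -ltNge; lra.
    have -> : 2 - 4 * r = 0 by lra.
    by rewrite !susp_le0.
  (* After the first quarter the path stays on the line over [s (e y)], going down from height 1 to
     0 and up again. The maximum with [z.2] cuts this dip off from below, until at [z.2 = 1] it is
     constant at the base point. *)
  pose L (z : Y * R * R) :=
    if 4 * z.1.2 - 1 <= 0 then susp z.1.1 (4 * z.1.2)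
    else susp (s (e z.1.1)) (Num.max (Num.max (2 - 4 * z.1.2) (2 * z.1.2 - 1))
      z.2).
  have cL : continuous L.
    apply: cts_if; [by ctss|by ctss|by ctss|].
    move=> [[y r] t] /= r4; rewrite !susp_ge1 // ?le_max ?(ler_pM2l) //; last
      lra.
    by apply/orP; left; apply/orP; left; lra.
  have E1 y r : K1 (y, r, 1) = N (y, r, 0).
    by rewrite /K1 /N /la /= subr0 mul1r (addrC (l y)) subrK !mulr1.
  have E2 y r : N (y, r, 1) = L (y, r, 0).
    rewrite /N /L /= subrr H0.
    case: (leP (2 * r - 1) 0) => r2; case: (leP (4 * r - 1) 0) => r4 //.
    - have -> : Num.max (2 - 4 * r) (2 * r - 1) = 2 - 4 * r.
        by apply/max_idPl; lra.
      by congr (susp _ _); apply/esym/max_idPl; lra.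
    - have r4' : 0 < 4 * r - 1 by lra.
      by rewrite leNgt r4' in r4.
    - have -> : Num.max (2 - 4 * r) (2 * r - 1) = 2 * r - 1.
        by apply/max_idPr; lra.
      by congr (susp _ _); apply/esym/max_idPl; lra.
  have E3 y r : L (y, r, 1) = susp y (4 * r).
    rewrite /L /=; case: (leP (4 * r - 1) 0) => r4 //.
    by rewrite !susp_ge1 // ?le_max ?lexx ?orbT //; lra.
  pose C (f g : Y * R * R -> Sigma Y) (z : Y * R * R) :=
    if 2 * z.2 - 1 <= 0 then f (z.1.1, z.1.2, 2 * z.2)
    else g (z.1.1, z.1.2, 2 * z.2 - 1).
  have cC (f' g' : Y * R * R -> Sigma Y) : continuous f' -> continuous g' ->
      (forall y r, f' (y, r, 1) = g' (y, r, 0)) -> continuous (C f' g').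
    move=> cf cg fg; apply: cts_if; [by ctss|by apply: cts_comp cf _; ctss|
      by apply: cts_comp cg _; ctss|].
    move=> [[y r] t] /= t2; rewrite t2 -fg.
    by have -> : 2 * t = 1 by lra.
  have C0 f' g' y r : C f' g' (y, r, 0) = f' (y, r, 0).
    by rewrite /C /= ifT ?mulr0 //; lra.
  have C1 f' g' y r : C f' g' (y, r, 1) = g' (y, r, 1).
    rewrite /C /= ifF; last by apply/negbTE; rewrite -ltNge; lra.
    by congr (g' (_, _, _)); lra.
  pose S (z : Y * R * R) := susp z.1.1 ((1 - z.2) * (4 * z.1.2) + z.2 * z.1.2).
  have cS : continuous S by rewrite /S; ctss.
  pose base (f' : Y * R * R -> Sigma Y) := forall t, 0 <= t -> t <= 1 ->
    [/\ forall y, f' (y, 0, t) = point, forall y, f' (y, 1, t) = point &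
        forall r, f' (point, r, t) = point].
  have baseC f' g' : base f' -> base g' -> base (C f' g').
    move=> bf bg t t0 t1; rewrite /C /=; case: (leP (2 * t - 1) 0) => t2.
      by apply: bf; lra.
    by apply: bg; lra.
  pose K := C (C K1 N) (C L S).
  have cK : continuous K.
    apply: (cC) => [||y r]; last by rewrite C1 C0.
      exact: (cC).
    by apply: (cC) => // y r; rewrite E3 /S /= subr0 mul1r mul0r addr0.
  have bK : base K.
    apply: (baseC); apply: (baseC) => t t0 t1; split => [y|y|r].
    - by rewrite /K1 /= !mulr0 !mul0r !ifT ?susp_le0 //; lra.
    - by rewrite /K1 /= ifF ?susp_ge1 //; [lra|apply/negbTE; rewrite -ltNge;
      lra].
    - by rewrite /K1 /= Hp !ep !sp !susp_pt !if_same.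
    - by rewrite /N /= !mulr0 !ifT ?susp_le0 //; lra.
    - by rewrite /N /= ifF ?susp_ge1 //; [lra|apply/negbTE; rewrite -ltNge;
      lra].
    - by rewrite /N /= Hp !ep !sp !susp_pt !if_same.
    - by rewrite /L /= !mulr0 !ifT ?susp_le0 //; lra.
    - rewrite /L /= ifF; last by apply/negbTE; rewrite -ltNge; lra.
      by rewrite susp_ge1 // !le_max; apply/orP; left; apply/orP; right; lra.
    - by rewrite /L /= ep sp !susp_pt; case: (_ <= _).
    - by rewrite /S /= susp_le0 //; lra.
    - by rewrite /S /= susp_ge1 //; lra.
    - by rewrite /S /= susp_pt.
  apply: (@susp_homotopy _ _ _ _ id _ _ K) => //.
  - exact: quotient_map_id.
  - move=> y r r0 r1; rewrite /K !C0 mE // /M /K1 /=.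
    case: (leP (2 * r - 1) 0) => r2; last by rewrite iAE.
    rewrite iQE /psi /la /=; [|lra|lra].
    have -> : 2 * (2 * r) = 4 * r by ring.
    by rewrite mul0r addr0.
  - by move=> y r r0 r1; rewrite /K !C1 /S /= subrr mul0r mul1r add0r.
  - by move=> y t t0 t1; case: (bK t t0 t1).
  - by move=> y t t0 t1; case: (bK t t0 t1).
  - by move=> x y r t _ _ _ _ /= ->.
  - by move=> x r t _ _ t0 t1 /= ->; case: (bK t t0 t1).
move=> bf bg /bh_real[KA [cKA KA0 KA1 KAp]] /bh_real[KQ [cKQ KQ0 KQ1 KQp]].
apply: (@bh_trans _ _ _ _ (f \o m)); first by apply: (bh_compl bf); exact:
  bh_sym.
apply: (@bh_trans _ _ _ _ (g \o m)); last exact: (bh_compl bg).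
apply: (@susp_homotopy _ _ _ _ id _ _ (fun z => if 2 * z.1.2 - 1 <= 0
  then KQ (susp (q z.1.1) (2 * z.1.2), z.2)
  else KA (susp (e z.1.1) (2 * z.1.2 - 1), z.2))).
- exact: quotient_map_id.
- apply: cts_if; [by ctss|by apply: cts_comp cKQ _; ctss|
    by apply: cts_comp cKA _; ctss|].
  by move=> [[y r] t] /= r2; rewrite r2 [susp _ 0]susp_le0 // KAp susp_ge1 ?KQp
    //; lra.
- move=> y r r0 r1 /=; rewrite mE // /M /= KQ0 // KA0 //=.
  by case: (_ <= _).
- move=> y r r0 r1 /=; rewrite mE // /M /= KQ1 // KA1 //=.
  by case: (_ <= _).
- by move=> y t _ _ /=; rewrite ifT ?susp_le0 ?KQp //; lra.
- move=> y t _ _ /=; rewrite ifF ?susp_ge1 ?KAp //; first lra.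
  by apply/negbTE; rewrite -ltNge; lra.
- by move=> x y r t _ _ _ _ /= ->.
- by move=> x r t _ _ _ _ /= ->; rewrite qp ep !susp_pt KQp KAp; case: (_ <= _).
Qed.

End split.

(** * Coproducts up to homotopy *)

Lemma dependent_family_choice (J : Type) (T : J -> Type)
    (Q : forall u, T u -> Prop) :
  (forall u, exists x, Q u x) -> exists f : forall u, T u, forall u, Q u (f u).
Proof.
by move=> H; exists (fun u => projT1 (cid (H u))) => u; exact: projT2.
Qed.

Section hcoproduct.
Context {R : realType}.
Implicit Types X Y Z : ptopologicalType.
Local Notation I := (unit_interval R).
Local Notation "f ~~ g" := (based_homotopic R f g) (at level 70).

(* [V] is a coproduct of the [W u], [P u], in the based homotopy category. *)
Definition hcoproduct (J : Type) (P : J -> Prop) (W : J -> ptopologicalType)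
    (V : ptopologicalType) (i : forall u, W u -> V) : Prop :=
  [/\ forall u, P u -> based_map (i u),
      forall Z (phi : forall u, W u -> Z), (forall u, P u -> based_map (phi u))
        ->
        exists2 f : V -> Z, based_map f & forall u, P u -> f \o i u ~~ phi u &
      forall Z (f g : V -> Z), based_map f -> based_map g ->
        (forall u, P u -> f \o i u ~~ g \o i u) -> f ~~ g].

Lemma hcoproduct_unique (J : Type) (W W' : J -> ptopologicalType) V V' i i' :
  @hcoproduct J (fun=> True) W V i -> @hcoproduct J (fun=> True) W' V' i' ->
  (forall u, based_homotopy_equivalent R (W u) (W' u)) ->
  based_homotopy_equivalent R V V'.
Proof.
move=> [bi exV uV] [bi' exV' uV'] WW'.
have [a aP] := dependent_family_choice WW'.
have [b abP] := dependent_family_choice aP => {aP}.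
have ba u : based_map (a u) by have [] := abP u.
have bb u : based_map (b u) by have [] := abP u.
have [f bf fP] := exV V' (fun u => i' u \o a u)
  (fun u _ => based_map_comp (bi' u Logic.I) (ba u)).
have [g bg gP] := exV' V (fun u => i u \o b u)
  (fun u _ => based_map_comp (bi u Logic.I) (bb u)).
exists f, g; split => //.
- apply: uV; [exact: based_map_comp|exact: based_map_id|move=> u _].
  apply: (@bh_trans _ _ _ _ (g \o (i' u \o a u))).
    exact: (bh_compl bg (fP u Logic.I)).
  apply: (@bh_trans _ _ _ _ ((i u \o b u) \o a u)).
    exact: (bh_compr (ba u) (gP u Logic.I)).
  by have [_ _ ab _] := abP u; exact: (bh_compl (bi u Logic.I) ab).
- apply: uV'; [exact: based_map_comp|exact: based_map_id|move=> u _].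
  apply: (@bh_trans _ _ _ _ (f \o (i u \o b u))).
    exact: (bh_compl bf (gP u Logic.I)).
  apply: (@bh_trans _ _ _ _ ((i' u \o a u) \o b u)).
    exact: (bh_compr (bb u) (fP u Logic.I)).
  by have [_ _ _ ba'] := abP u; exact: (bh_compl (bi' u Logic.I) ba').
Qed.

(** Homotopies on the summands are based, so they agree at the common point and glue. The glued map
    is continuous on the product with the interval by [continuous_sink_prod], applied to the
    inclusions of all summands at once. *)
Lemma hcoproduct_pwedge (J : pointedType) (W : J -> ptopologicalType) :
  @hcoproduct J (fun=> True) W (pwedge W) (@wedge_lift J W (fun=> point)).
Proof.
have bl u : based_map (@wedge_lift J W (fun=> point) u : W u -> pwedge W).
  by split; [exact: wedge_lift_continuous | exact: (@wedge_liftE J W (fun=>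
    point) point point u point)].
split=> [u _ //|Z phi bphi|Z f g bf bg fg].
  have E u v : phi u point = phi v point.
    by have [_ ->] := bphi u Logic.I; have [_ ->] := bphi v Logic.I.
  exists (wedge_fun phi).
    split; first by apply: wedge_fun_continuous => // u; have [] := bphi u
      Logic.I.
    rewrite [point]/(wedge_lift _ _) wedge_lift_funE //.
    by have [_ ->] := bphi point Logic.I.
  move=> u _; rewrite (_ : _ \o _ = phi u); first exact/bh_refl/bphi.
  by apply/funext => w /=; rewrite wedge_lift_funE.
have [h hP] := dependent_family_choice (fun u => fg u Logic.I).
have E (t : I) u v : h u (point, t) = h v (point, t).
  by have [_ _ _ ->] := hP u; have [_ _ _ ->] := hP v.
have sq (v : pwedge W) : exists u w, @wedge_lift J W (fun=> point) u w = v.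
  have : [set: pwedge W] v by [].
  by rewrite -wedgeTE => -[u _ [w _ <-]]; exists u, w.
exists (fun z => wedge_fun (fun u w => h u (w, z.2)) z.1); split.
- apply: (@continuous_sink_prod J W (pwedge W) I Z
    (@wedge_lift J W (fun=> point))) => //.
  + exact: unit_interval_lc.
  + exact: unit_interval_hausdorff.
  + move=> Z' k ck; apply/continuousP => A oA; apply/wedge_openP => u.
    by have /continuousP/(_ A oA) := ck u.
  + move=> u /=; have [ch _ _ _] := hP u.
    apply: cts_eq ch => z; rewrite wedge_lift_funE //; by case: z.
- move=> v; have [u [w <-]] := sq v; rewrite wedge_lift_funE //=.
  by have [_ -> _ _] := hP u.
- move=> v; have [u [w <-]] := sq v; rewrite wedge_lift_funE //=.
  by have [_ _ -> _] := hP u.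
- move=> t; rewrite [point]/(wedge_lift _ _) wedge_lift_funE //=.
  by have [_ _ _ ->] := hP point.
Qed.

(** Base case of the splitting induction. Families are indexed by all of [J] and tested only on [P],
    so the maps at other indices may be constant. *)
Lemma hcoproduct_one (J : Type) (P : J -> Prop) (W : J -> ptopologicalType)
    (u0 : J) : (forall u, P u <-> u = u0) ->
  exists i : forall u, W u -> W u0, hcoproduct P i.
Proof.
move=> PE.
pose i u : W u -> W u0 := if pselect (u = u0) is left E
  then fun x => ecast u (W u) E x else fun=> point.
have iE : i u0 = id.
  by rewrite /i; case: pselect => // E; rewrite (Prop_irrelevance E erefl).
exists i; split.
- by move=> u /PE ->; rewrite iE; exact: based_map_id.
- move=> Z phi bphi; have bu0 := bphi u0 (proj2 (PE u0) erefl).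
  by exists (phi u0) => // u /PE ->; rewrite iE; exact: bh_refl.
- by move=> Z f g _ _ /(_ u0 (proj2 (PE u0) erefl)); rewrite iE.
Qed.

Lemma hcoproduct_split (J : Type) (P PA PQ : J -> Prop)
    (W : J -> ptopologicalType) (A Q V : ptopologicalType)
    (jA : forall u, W u -> A) (jQ : forall u, W u -> Q)
    (iA : A -> V) (iQ : Q -> V) :
  (forall u, P u <-> (PA u \/ PQ u)) -> (forall u, PA u -> ~ PQ u) ->
  based_map iA -> based_map iQ ->
  (forall Z (phA : A -> Z) (phQ : Q -> Z), based_map phA -> based_map phQ ->
    exists f : V -> Z, [/\ based_map f, f \o iA ~~ phA & f \o iQ ~~ phQ]) ->
  (forall Z (f g : V -> Z), based_map f -> based_map g -> f \o iA ~~ g \o iA ->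
    f \o iQ ~~ g \o iQ -> f ~~ g) ->
  hcoproduct PA jA -> hcoproduct PQ jQ ->
  exists i : forall u, W u -> V, hcoproduct P i.
Proof.
move=> PE PAQ bA bQ ex un [bjA exA unA] [bjQ exQ unQ].
pose i u : W u -> V := if `[< PQ u >] then iQ \o jQ u else iA \o jA u.
have iAE u : PA u -> i u = iA \o jA u.
  by move=> /PAQ pq; rewrite /i asboolF.
have iQE u : PQ u -> i u = iQ \o jQ u by move=> pq; rewrite /i asboolT.
exists i; split.
- move=> u /PE[p|p]; first by rewrite iAE //; exact: (based_map_comp bA (bjA u
  p)).
  by rewrite iQE //; exact: (based_map_comp bQ (bjQ u p)).
- move=> Z phi bphi.
  have [fA bfA fAP] := exA Z phi (fun u p => bphi u (proj2 (PE u) (or_introl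
    p))).
  have [fQ bfQ fQP] := exQ Z phi (fun u p => bphi u (proj2 (PE u) (or_intror
    p))).
  have [f [bf fA' fQ']] := ex Z fA fQ bfA bfQ.
  exists f => // u /PE[p|p].
    rewrite iAE //; apply: bh_trans (fAP u p).
    exact: (bh_compr (bjA u p) fA').
  rewrite iQE //; apply: bh_trans (fQP u p).
  exact: (bh_compr (bjQ u p) fQ').
- move=> Z f g bf bg fg; apply: un => //.
    apply: unA => [||u p]; try exact: based_map_comp.
    by have := fg u (proj2 (PE u) (or_introl p)); rewrite iAE.
  apply: unQ => [||u p]; try exact: based_map_comp.
  by have := fg u (proj2 (PE u) (or_intror p)); rewrite iQE.
Qed.

Lemma hcoproduct_equiv (J : Type) (P : J -> Prop) (W : J -> ptopologicalType)
    (V V' : ptopologicalType)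
    (i : forall u, W u -> V) (f : V -> V') (g : V' -> V) :
  based_map f -> based_map g -> cancel f g -> cancel g f -> hcoproduct P i ->
  hcoproduct P (fun u => f \o i u).
Proof.
move=> bf bg fK gK [bi ex un]; split => [u p|Z phi bphi|Z a b ba bb ab].
- by apply: based_map_comp => //; exact: bi.
- have [h bh hP] := ex Z phi bphi.
  exists (h \o g); first exact: based_map_comp.
  move=> u p; rewrite (_ : _ \o _ = h \o i u); first exact: hP.
  by apply/funext => w /=; rewrite fK.
- have H : a \o f ~~ b \o f by apply: un => //; exact: based_map_comp.
  have := bh_compr bg H.
  rewrite (_ : a \o f \o g = a); last by apply/funext => w /=; rewrite gK.
  by rewrite (_ : b \o f \o g = b) //; apply/funext => w /=; rewrite gK.
Qed.

End hcoproduct.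
Arguments hcoproduct R [J] P [W V] i.

(** * Commuting retractions *)

Lemma subset_setC1 (J : finType) (u : {set J}) j :
  (u \subset ~: [set j]%SET) = (j \notin u).
Proof. by rewrite -finset.disjoints_subset disjoint_sym finset.disjoints1. Qed.

Section tower.
Context {R : realType} {J : finType} {X : ptopologicalType}.
Local Notation I := (unit_interval R).
Local Notation "f ~~ g" := (based_homotopic R f g) (at level 70).
Local Notation Sigma := (reduced_suspension R).
Context (e : {set J} -> X -> X).

Definition fixed_by (i : J) (x : X) : bool := e [set i]%SET x == x.

Definition fixed_by_some (w : {set J}) (x : X) : bool :=
  [exists i in w, fixed_by i x].

Section thom.
Context (v w : {set J}).

(** The image of [e v] with some points collapsed is presented as a quotient of [X] itself, not of a
    subspace: maps out of all these spaces then descend from [X] in the same way. *)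
Let rel (x y : X) := (e v x == e v y) ||
  (fixed_by_some w (e v x) && fixed_by_some w (e v y)).

Let rel_refl : reflexive rel.
Proof. by move=> x; rewrite /rel eqxx. Qed.

Let rel_sym : symmetric rel.
Proof. by move=> x y; rewrite /rel eq_sym andbC. Qed.

Let rel_trans : transitive rel.
Proof.
move=> y x z /orP[/eqP xy|/andP[xw yw]] /orP[/eqP yz|/andP[yw' zw]];
rewrite /rel; rewrite ?xy ?yz ?eqxx //.
- by rewrite yw' zw orbT.
- by rewrite xw -yz yw orbT.
- by rewrite xw zw orbT.
Qed.

Definition thom_rel := EquivRel rel rel_refl rel_sym rel_trans.

(* For [v = ~: w] and the retractions onto sections of sphere bundles, this is
   the Thom space of the sum of the normal bundles of the sections in [w]. *)
Definition thom := quotient_topology {eq_quot thom_rel}.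

HB.instance Definition _ := PointedTopological.on thom.
HB.instance Definition _ := Quotient.on thom.

Definition thom_pi : X -> thom := \pi_thom.

Lemma thom_piP x y : thom_pi x = thom_pi y <->
  e v x = e v y \/ fixed_by_some w (e v x) /\ fixed_by_some w (e v y).
Proof.
split=> [/eqmodP/orP[/eqP ->|/andP[-> ->]]|]; [by left|by right|].
case=> [xy|[xw yw]]; apply/eqmodP; rewrite /= /rel; first by rewrite xy eqxx.
by rewrite xw yw orbT.
Qed.

Lemma quotient_map_thom : quotient_map thom_pi.
Proof. exact: quotient_map_pi. Qed.

End thom.

Context (ce : forall v, continuous (e v)) (e0 : forall x, e finset.set0 x = x).
(** Indexing the composites by the set of retractions involved puts commutation and idempotence into
    this single identity. *)
Context (eU : forall v w x, e v (e w x) = e (v :|: w) x).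
Context (ep : forall v, e v point = point).

Lemma fixed_by_e i v x : fixed_by i x -> fixed_by i (e v x).
Proof. by rewrite /fixed_by eU finset.setUC -eU => /eqP ->. Qed.

Lemma fixed_by_mem i (v : {set J}) x : i \in v -> fixed_by i (e v x).
Proof. by move=> iv; rewrite /fixed_by eU (finset.setUidPr _) // finset.sub1set.
  Qed.

Lemma fixed_by_pt i : fixed_by i point.
Proof. by rewrite /fixed_by ep. Qed.

Lemma fixed_by_some_e w v x : fixed_by_some w x -> fixed_by_some w (e v x).
Proof.
by move=> /exists_inP[i iw ix]; apply/exists_inP; exists i => //; exact:
  fixed_by_e.
Qed.

Lemma fixed_by_someU w i x :
  fixed_by_some (i |: w) x = fixed_by i x || fixed_by_some w x.
Proof.
apply/exists_inP/orP => [[k]|[ix|/exists_inP[k kw kx]]].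
- rewrite !inE => /orP[/eqP ->|kw] kx; first by left.
  by right; apply/exists_inP; exists k.
- by exists i => //; rewrite !inE eqxx.
- by exists k => //; rewrite !inE kw orbT.
Qed.

Lemma eK v x : e v (e v x) = e v x.
Proof. by rewrite eU finset.setUid. Qed.

(** One homotopy serves all retractions: it preserves every fixed set and pushes the neighbourhood
    [l i < 1] of each into it. This is what lets the data descend to the iterated quotients. *)
Context (H : X * R -> X) (cH : continuous H) (H0 : forall x, H (x, 0) = x).
Context (Hp : forall r, H (point, r) = point).
Context (Hfix : forall i x r, fixed_by i x -> fixed_by i (H (x, r))).
Context (l : J -> X -> R) (cl : forall i, continuous (l i)).
Context (l0 : forall i x, 0 <= l i x).
Context (lfix : forall i x, fixed_by i x -> l i x = 0).
Context (lH : forall i x, l i x < 1 -> fixed_by i (H (x, 1))).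

(** The retract splitting for [Y = thom v w] and its retraction induced by the index [j]: the
    retract is [thom (j |: v) w], and collapsing it gives [thom v (j |: w)]. *)
Lemma thom_split (v w : {set J}) (j : J) :
  exists (iA : Sigma (thom (j |: v) w) -> Sigma (thom v w))
         (iQ : Sigma (thom v (j |: w)) -> Sigma (thom v w)),
  [/\ based_map iA, based_map iQ,
      forall (Z : ptopologicalType) (phA : Sigma (thom (j |: v) w) -> Z)
             (phQ : Sigma (thom v (j |: w)) -> Z),
        based_map phA -> based_map phQ ->
        exists f : Sigma (thom v w) -> Z,
          [/\ based_map f, f \o iA ~~ phA & f \o iQ ~~ phQ] &
      forall (Z : ptopologicalType) (f g : Sigma (thom v w) -> Z), based_map f
        -> based_map g ->
        f \o iA ~~ g \o iA -> f \o iQ ~~ g \o iQ -> f ~~ g].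
Proof.
pose piY := @thom_pi v w; pose piA := @thom_pi (j |: v) w.
pose piQ := @thom_pi v (j |: w).
have qY : quotient_map piY := quotient_map_thom v w.
have qA : quotient_map piA := quotient_map_thom _ _.
have qQ : quotient_map piQ := quotient_map_thom _ _.
have [cY sY uY] := qY; have [cA sA uA] := qA; have [cQ sQ uQ] := qQ.
have ejv x : e (j |: v) x = e [set j]%SET (e v x) by rewrite eU.
have evj x : e v (e (j |: v) x) = e (j |: v) x.
  by rewrite eU finset.setUCA finset.setUid.
have [||s cs sE] := @quotient_map_descend _ _ (thom v w) piA
    (fun x => piY (e (j |: v) x)) qA.
- exact: (cts_comp cY (@ce _)).
- move=> x y /thom_piP xy; apply/thom_piP; rewrite !evj.
  by case: xy => [->|]; [left|right].
have [||r cr rE] := @quotient_map_descend _ _ (thom (j |: v) w) piY piA qY.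
- exact: cA.
- move=> x y /thom_piP[xy|[xw yw]]; apply/thom_piP; rewrite !ejv.
    by rewrite xy; left.
  by right; split; exact: fixed_by_some_e.
have [||q cq qE] := @quotient_map_descend _ _ (thom v (j |: w)) piY piQ qY.
- exact: cQ.
- move=> x y /thom_piP[xy|[xw yw]]; apply/thom_piP; first by left.
  by right; rewrite !fixed_by_someU xw yw !orbT.
have ptY : piY point = point by [].
have ptA : piA point = point by [].
have ptQ : piQ point = point by [].
have range_s x : fixed_by j (e v x) || fixed_by_some w (e v x) -> range s (piY
  x).
  move=> xj; exists (piA x) => //; rewrite sE; apply/thom_piP; rewrite evj ejv.
  case/orP: xj => [/eqP ->|xw]; first by left.
  by right; split=> //; exact: fixed_by_some_e.
have range_sv x : fixed_by j x || fixed_by_some w x -> range s (piY x).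
  case/orP => [xj|xw]; apply: range_s.
    by rewrite fixed_by_e.
  by rewrite fixed_by_some_e ?orbT.
have HK x t : fixed_by_some w x -> fixed_by_some w (H (x, t)).
  by case/exists_inP => i iw ix; apply/exists_inP; exists i => //; exact: Hfix.
have piYe x : piY (e v x) = piY x by apply/thom_piP; left; rewrite eK.
have [||h ch hE] := @quotient_map_descend _ _ (thom v w) _
    (fun z : X * I => piY (H (e v z.1, \val z.2))) (quotient_map_unit qY).
- apply: cts_comp cY _; apply: cts_comp cH _; ctsu.
  by apply: cts_comp (@ce v) _; cts.
- move=> [x a] [y b] /= [/thom_piP[xy|[xw yw]] ->].
    by rewrite xy.
  by apply/thom_piP; right; split; apply: fixed_by_some_e; exact: HK.
pose HY (z : thom v w * R) := h (z.1, clip z.2).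
have HYE x t : HY (piY x, t) = piY (H (e v x, \val (clip t))).
  by rewrite /HY (hE (x, clip t)).
(* The minimum is over [j |: w], not just [j]: the level has to be 0 on the points already collapsed
   in order to descend. If it is below 1 because of some [i] in [w], [H] ends at the base point,
   which is in the retract too. *)
pose lY0 x : R := \big[Num.min/1]_(i in j |: w) l i (e v x).
have lY0_0 x : fixed_by_some (j |: w) (e v x) -> lY0 x = 0.
  case/exists_inP => i iw ix; apply/le_anti/andP; split.
    by rewrite /lY0 (bigminD1 i) //= ge_min lfix // lexx.
  by apply/bigmin_geP; split.
have [||lY clY lYE] := @quotient_map_descend _ _ R piY lY0 qY.
- apply: cts_big => [? ?|i _]; [exact: cts_min|].
  exact: (cts_comp (@cl i) (@ce v)).
- move=> x y /thom_piP[xy|[xw yw]]; first by rewrite /lY0 xy.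
  by rewrite !lY0_0 // fixed_by_someU ?xw ?yw orbT.
have sr : based_map s.
  by split => //; rewrite -ptA sE ep.
have bs : cancel s r.
  move=> a; have [x <-] := sA a; rewrite sE rE; apply/thom_piP; left.
  by rewrite eK.
have br : based_map r by split => //; rewrite -ptY rE.
have qq : quotient_map q.
  split => //.
    by move=> y; have [x <-] := sQ y; exists (piY x).
  by move=> Z g cg; apply: uQ; apply: cts_eq (cts_comp cg cY) => x; rewrite qE.
have qinj x y : q x = q y -> x = y \/ range s x /\ range s y.
  have [x' <-] := sY x; have [y' <-] := sY y; rewrite !qE.
  move=> /thom_piP[xy|[]]; first by left; apply/thom_piP; left.
  by rewrite !fixed_by_someU => xw yw; right; split; exact: range_s.
have qs a : q (s a) = point.
  have [x <-] := sA a; rewrite sE qE -ptQ; apply/thom_piP; right.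
  by rewrite !fixed_by_someU ep fixed_by_pt evj fixed_by_mem // !inE eqxx.
have cHY : continuous HY.
  by apply: cts_comp ch _; ctsu.
have HY0 y : HY (y, 0) = y.
  by have [x <-] := sY y; rewrite HYE val_clip // H0 piYe.
have HYp t : HY (point, t) = point by rewrite -ptY HYE ep Hp.
have HYs a t : range s (HY (s a, t)).
  have [x <-] := sA a; rewrite sE HYE evj; apply: range_sv.
  by rewrite Hfix // fixed_by_mem // !inE eqxx.
have lY_0 y : 0 <= lY y.
  by have [x <-] := sY y; rewrite lYE; apply/bigmin_geP; split.
have lY_1 y : lY y <= 1.
  by have [x <-] := sY y; rewrite lYE; exact: bigmin_le_id.
have lYs a : lY (s a) = 0.
  have [x <-] := sA a; rewrite sE lYE lY0_0 // fixed_by_someU evj.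
  by rewrite fixed_by_mem // !inE eqxx.
have lYH y : lY y < 1 -> range s (HY (y, 1)).
  have [x <-] := sY y; rewrite lYE /lY0 HYE val_clip // => lx.
  have [i iw ix] : exists2 i, i \in j |: w & l i (e v x) < 1.
    move: lx; rewrite ltNge => /negP lx; apply: contrapT => nx; apply: lx.
    apply/bigmin_geP; split=> // i iw; rewrite leNgt; apply/negP => ix.
    by apply: nx; exists i.
  apply: range_sv; rewrite -fixed_by_someU; apply/exists_inP; exists i => //.
  exact: lH.
have [iA [iQ [biA biQ iAE iQE]]] := split_maps (R := R) sr br bs qq qinj qs
  cHY clY lY_1 lYs lYH.
exists iA, iQ; split => //.
- move=> Z phA phQ bphA bphQ.
  by apply: (split_extension sr br bs qq qinj qs cHY HY0 HYs clY lY_0 lY_1 lYs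
    lYH
    iAE iQE bphA bphQ).
- move=> Z f g; exact: (split_uniqueness sr br bs qq qs cHY HY0 HYp clY lY_1
    lYH biA biQ iAE iQE).
Qed.

(** Induction on the number of indices in neither [v] nor [w]. Splitting at such a [j] either
    retracts it, putting it into [v], or collapses it, putting it into [w]; this matches the
    division of the sets [u] by whether they contain [j]. *)
Lemma thom_hcoproduct (v w : {set J}) : v \subset ~: w ->
  exists i : forall u, Sigma (thom (~: u) u) -> Sigma (thom v w),
    hcoproduct R (fun u : {set J} => w \subset u /\ u \subset ~: v) i.
Proof.
have [k] := ubnP #|~: (v :|: w)|; elim: k => // k IH in v w *.
rewrite ltnS => vwk vw.
have [jE|/set0Pn[j]] := eqVneq (~: (v :|: w)) finset.set0; last first.
  rewrite !inE negb_or => /andP[jv jw].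
  have [iA [iQ [bA bQ ex un]]] := thom_split v w j.
  have lt (a b : {set J}) : j \in ~: (v :|: w) -> j \in a :|: b ->
      v :|: w \subset a :|: b -> (#|~: (a :|: b)| < k)%N.
    move=> jvw jab sub; apply: leq_trans vwk; apply: proper_card.
    apply/properP; split; first by rewrite finset.setCS.
    by exists j => //; rewrite inE jab.
  have [||jA hA] := IH (j |: v) w.
  - apply: lt; rewrite ?inE ?eqxx ?negb_or ?jv //.
    by apply: finset.setSU; exact: finset.subsetUr.
  - by rewrite finset.subUset finset.sub1set inE jw.
  have [||jQ hQ] := IH v (j |: w).
  - apply: lt; rewrite ?inE ?eqxx ?negb_or ?jv ?orbT //.
    by apply: finset.setUS; exact: finset.subsetUr.
  - by rewrite finset.setCU finset.subsetI subset_setC1 jv.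
  apply: (hcoproduct_split _ _ bA bQ ex un hA hQ) => u.
    rewrite finset.setCU finset.subsetI subset_setC1.
    rewrite finset.subUset finset.sub1set.
    split=> [[wu uv]|[[wu /andP[ju uv]]|[/andP[ju wu] uv]]] //.
    by rewrite wu uv; case: (j \in u); [right|left].
  rewrite finset.setCU finset.subsetI subset_setC1 finset.subUset
    finset.sub1set.
  by move=> [_ /andP[/negP ju _]] [/andP[]].
have vE : v = ~: w.
  apply/eqP; rewrite finset.eqEsubset vw /=; apply/fintype.subsetP => x.
  have := finset.in_set0 x; rewrite -jE !inE.
  by case: (x \in v) => //=; case: (x \in w).
rewrite {}vE {jE vwk vw}; apply: hcoproduct_one => u; rewrite finset.setCK.
split => [[wu uw]|->]; last by rewrite subxx.
by apply/eqP; rewrite finset.eqEsubset wu uw.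
Qed.

(** With [v] and [w] empty nothing is retracted or collapsed, so the quotient is homeomorphic to [X]
    and the coproduct can be carried over. *)
Lemma thom_splitting : exists i : forall u, Sigma (thom (~: u) u) -> Sigma X,
  hcoproduct R (fun=> True) i.
Proof.
have [|i hi] := @thom_hcoproduct finset.set0 finset.set0.
  exact: finset.sub0set.
have piinj : injective (thom_pi finset.set0 finset.set0).
  move=> x y /thom_piP[|[/exists_inP[k]]]; last by rewrite inE.
  by rewrite !e0.
have qpi := quotient_map_thom finset.set0 finset.set0.
have [//|//|g cg gE] := @quotient_map_descend _ _ X _ id qpi; first exact:
  cts_id.
have [cpi sT _] := qpi.
have gK : cancel g (thom_pi finset.set0 finset.set0).
  by move=> y; have [x <-] := sT y; rewrite gE.
have bpi : based_map (thom_pi finset.set0 finset.set0) by [].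
have bg : based_map g by split => //; rewrite -[RHS]gE.
have [f bf fE] := susp_map (R := R) bg.
have [f' bf' fE'] := susp_map (R := R) bpi.
have fK : cancel f f'.
  by move=> z; have [x [r [_ _ ->]]] := susp_surj z; rewrite fE fE' gK.
have fK' : cancel f' f.
  by move=> z; have [x [r [_ _ ->]]] := susp_surj z; rewrite fE' fE gE.
exists (fun u => f \o i u).
have := hcoproduct_equiv bf bf' fK fK' hi.
rewrite (_ : (fun u : {set J} => _ /\ _) = fun=> True) //.
by apply/funext => u; rewrite finset.sub0set finset.setC0 finset.subsetT;
  apply/propext.
Qed.

End tower.

(** * Spheres *)

Section dot.
Context {R : realType} {k : nat}.
Implicit Types a b c : 'rV[R]_k.

Definition dot a b : R := \sum_i a ord0 i * b ord0 i.

Lemma dotC a b : dot a b = dot b a.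
Proof. by apply: eq_bigr => i _; rewrite mulrC. Qed.

Lemma dotDl a b c : dot (a + b) c = dot a c + dot b c.
Proof. by rewrite -big_split; apply: eq_bigr => i _; rewrite mxE mulrDl. Qed.

Lemma dotZl (r : R) a b : dot (r *: a) b = r * dot a b.
Proof. by rewrite mulr_sumr; apply: eq_bigr => i _; rewrite mxE mulrA. Qed.

Lemma dotNl a b : dot (- a) b = - dot a b.
Proof. by rewrite -scaleN1r dotZl mulN1r. Qed.

Lemma dotDr a b c : dot c (a + b) = dot c a + dot c b.
Proof. by rewrite dotC dotDl !(dotC _ c). Qed.

Lemma dotZr (r : R) a b : dot a (r *: b) = r * dot a b.
Proof. by rewrite dotC dotZl dotC. Qed.

Lemma dotNr a b : dot a (- b) = - dot a b.
Proof. by rewrite dotC dotNl dotC. Qed.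

Lemma dot_ge0 a : 0 <= dot a a.
Proof. by apply: sumr_ge0 => i _; rewrite -expr2 sqr_ge0. Qed.

Lemma dot_eq0 a : (dot a a == 0) = (a == 0).
Proof.
apply/eqP/eqP => [/eqP|->]; last by rewrite -(scale0r 0) dotZl mul0r.
rewrite psumr_eq0 => [/allP a0|i _]; last by rewrite -expr2 sqr_ge0.
apply/rowP => i; have := a0 i (mem_index_enum i).
by rewrite mulf_eq0 orbb mxE => /eqP.
Qed.

Definition euclid a : R := Num.sqrt (dot a a).

Lemma euclid_ge0 a : 0 <= euclid a. Proof. exact: sqrtr_ge0. Qed.

Lemma euclid_sqr a : euclid a ^+ 2 = dot a a.
Proof. by rewrite sqr_sqrtr // dot_ge0. Qed.

Lemma euclid_gt0 a : (0 < euclid a) = (a != 0).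
Proof. by rewrite sqrtr_gt0 lt_def dot_ge0 andbT dot_eq0. Qed.

Lemma euclidZ r a : euclid (r *: a) = `|r| * euclid a.
Proof.
rewrite /euclid dotZl dotZr mulrA -expr2 sqrtrM ?sqr_ge0 //.
by rewrite sqrtr_sqr.
Qed.

Lemma euclidN a : euclid (- a) = euclid a.
Proof. by rewrite /euclid dotNl dotNr opprK. Qed.

Lemma cts_dot (T : topologicalType) (f g : T -> 'rV[R]_k) :
  continuous f -> continuous g -> continuous (fun x => dot (f x) (g x)).
Proof.
by move=> cf cg; apply: cts_big => [? ?|i _]; [exact: ctsD|]; apply: ctsM;
  apply: cts_coord.
Qed.

Lemma cts_euclid (T : topologicalType) (f : T -> 'rV[R]_k) :
  continuous f -> continuous (fun x => euclid (f x)).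
Proof. by move=> cf; apply: cts_sqrt; apply: cts_dot. Qed.

Lemma cts_rowD (T : topologicalType) (f g : T -> 'rV[R]_k) :
  continuous f -> continuous g -> continuous (fun x => f x + g x).
Proof.
move=> cf cg; apply: cts_row => j.
by under eq_fun do rewrite mxE; apply: ctsD; apply: cts_coord.
Qed.

Lemma cts_rowZ (T : topologicalType) (f : T -> R) (g : T -> 'rV[R]_k) :
  continuous f -> continuous g -> continuous (fun x => f x *: g x).
Proof.
move=> cf cg; apply: cts_row => j.
by under eq_fun do rewrite mxE; apply: ctsM => //; apply: cts_coord.
Qed.

End dot.

Lemma set_type_compact (T : topologicalType) (A : set T) :
  compact A -> compact [set: set_type A].
Proof.
move=> cA F PF _.
have FA : F (fun x => A (\val x)).
  by apply: filterS filterT => -[x xA] _; exact: set_mem.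
have [p [Ap pF]] := cA ((fun x : set_type A => \val x) @ F) _ FA.
exists (SigSub (mem_set Ap)); split => // U V FU [_ /= [[W oW <-]]] /= Wp WV.
have FU' : F (fun x : set_type A => ((fun x : set_type A => \val x) @` U) (\val
  x)).
  by apply: filterS FU => u Uu; exists u.
have [y [[u Uu uy] Wy]] := pF _ W FU' (open_nbhs_nbhs (conj oW Wp)).
by exists u; split => //; apply: WV; rewrite /= set_valE /= uy.
Qed.

Section sphere.
Context {R : realType}.

Lemma sphere_dot k (x : sphere R k) : dot (\val x) (\val x) = 1.
Proof.
have /set_mem xS := valP x; apply: etrans xS.
by apply: eq_bigr => i _; rewrite expr2.
Qed.

Lemma sphere_euclid k (x : sphere R k) : euclid (\val x) = 1.
Proof. by rewrite /euclid sphere_dot sqrtr1. Qed.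

Lemma sphere_neq0 k (x : sphere R k) : \val x != 0.
Proof. by rewrite -dot_eq0 sphere_dot oner_eq0. Qed.

Lemma sphere_neqN k (x : sphere R k) : x <> antipode x.
Proof.
move=> /(congr1 (fun y : sphere R k => dot (\val y) (\val x))) /=.
rewrite dotNl sphere_dot => h; have : (1 : R) = 0 by lra.
by move/eqP; rewrite oner_eq0.
Qed.

Lemma dot_inS k (a : 'rV[R]_k.+1) : dot a a = 1 -> a \in @sphere_set R k.
Proof.
by move=> a1; apply/mem_set; rewrite /sphere_set /= -a1; apply: eq_bigr.
Qed.

Lemma sphere_dot_le1 k (x y : sphere R k) : dot (\val x) (\val y) <= 1.
Proof.
have := dot_ge0 (\val x - \val y).
rewrite !(dotDl, dotDr, dotNl, dotNr) !sphere_dot (dotC (\val y)); lra.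
Qed.

Lemma sphere_dot_eq1 k (x y : sphere R k) : dot (\val x) (\val y) = 1 -> x = y.
Proof.
move=> xy; apply: val_inj; apply/eqP; rewrite -subr_eq0 -dot_eq0.
rewrite !(dotDl, dotDr, dotNl, dotNr) !sphere_dot (dotC (\val y)) xy; lra.
Qed.

(** Total, with the base point as value at 0. *)
Definition normalize k (a : 'rV[R]_k.+1) : sphere R k :=
  if pselect (dot ((euclid a)^-1 *: a) ((euclid a)^-1 *: a) = 1) is left h
  then SigSub (dot_inS h) else point.

Lemma val_normalize k (a : 'rV[R]_k.+1) : a != 0 ->
  \val (normalize a) = (euclid a)^-1 *: a.
Proof.
move=> a0; rewrite /normalize; case: pselect => // -[].
rewrite dotZl dotZr -euclid_sqr expr2 !mulrA.
have e0 : euclid a != 0 by rewrite gt_eqF // euclid_gt0.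
by rewrite -mulrA -invfM mulrC divff // mulf_neq0.
Qed.

Lemma normalizeZ k (c : R) (x : sphere R k) : 0 < c ->
  normalize (c *: \val x) = x.
Proof.
move=> c0; apply: val_inj; rewrite val_normalize.
  by rewrite euclidZ sphere_euclid mulr1 gtr0_norm // scalerA mulVf ?scale1r //
    gt_eqF.
by rewrite scaler_eq0 negb_or gt_eqF //= sphere_neq0.
Qed.

Lemma normalizeK k (x : sphere R k) : normalize (\val x) = x.
Proof. by rewrite -[\val x]scale1r normalizeZ. Qed.

Lemma normalizeN k (a : 'rV[R]_k.+1) : a != 0 ->
  normalize (- a) = antipode (normalize a).
Proof.
move=> a0; apply: val_inj; rewrite /= val_normalize ?oppr_eq0 //.
by rewrite val_normalize // euclidN scalerN.
Qed.

Lemma cts_normalize k (T : topologicalType) (f : T -> 'rV[R]_k.+1) :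
  (forall x, f x != 0) -> continuous f -> continuous (fun x => normalize (f x)).
Proof.
move=> f0 cf; apply: cts_sub.
apply: (@cts_eq _ _ (fun x => (euclid (f x))^-1 *: f x)).
  by move=> x; rewrite val_normalize.
apply: cts_rowZ => //; apply: ctsV; last exact: cts_euclid.
by move=> x; rewrite gt_eqF // euclid_gt0.
Qed.

Lemma cts_sval k (T : topologicalType) (f : T -> sphere R k) :
  continuous f -> continuous (fun x => \val (f x) : 'rV[R]_k.+1).
Proof. by apply: cts_comp; exact: initial_continuous. Qed.

Lemma sphere_compact k : compact [set: sphere R k].
Proof.
have cS : compact (@sphere_set R k).
  apply: bounded_closed_compact.
    exists 1; split; first exact: num_real.
    move=> M M1 a; rewrite /sphere_set /= => aS.
    rewrite [`|_|]mx_normrE; apply/bigmax_leP; split; first exact/ltW/(lt_trans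
      ltr01).
    move=> [i j] _ /=; rewrite (ord1 i).
    apply: le_trans (ltW M1); rewrite -(ler_pXn2r (ltn0Sn 1)) ?nnegrE // expr1n.
    rewrite real_normK ?num_real // -aS (bigD1 j) //= lerDl.
    by apply: sumr_ge0 => q _; exact: sqr_ge0.
  rewrite (_ : @sphere_set R k = (fun a : 'rV[R]_k.+1 => dot a a) @^-1` [set
    1]).
    apply: closed_comp; last exact: closed_eq.
    by move=> a _; apply: cts_dot; cts.
  by apply/seteqP; split => a; rewrite /sphere_set /= => <-; apply: eq_bigr => i
    _;
    rewrite expr2.
exact: set_type_compact.
Qed.

Definition pad_row (m k : nat) (a : 'rV[R]_m.+1) : 'rV[R]_k.+1 :=
  \row_j (if (j <= m)%N then a ord0 (inord j) else 0).

Lemma pad_rowN m k (a : 'rV[R]_m.+1) : pad_row k (- a) = - pad_row k a.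
Proof. by apply/rowP => j; rewrite !mxE; case: ifP => // _; rewrite ?mxE ?oppr0.
  Qed.

Lemma dot_pad_row m k (a : 'rV[R]_m.+1) : (m <= k)%N ->
  dot (pad_row k a) (pad_row k a) = dot a a.
Proof.
move=> mk; rewrite /dot (eq_bigr (fun j : 'I_k.+1 => if (j < m.+1)%N
  then a ord0 (inord j) ^+ 2 else 0)); last first.
  by move=> j _; rewrite !mxE ltnS; case: leqP => _; rewrite ?mulr0 // expr2.
rewrite -big_mkcond -(big_ord_widen _ (fun j => a ord0 (inord j) ^+ 2)) //.
by apply: eq_bigr => j _; rewrite inord_val expr2.
Qed.

Lemma cts_pad_row m k (T : topologicalType) (f : T -> 'rV[R]_m.+1) :
  continuous f -> continuous (fun x => pad_row k (f x)).
Proof.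
move=> cf; apply: cts_row => j.
apply: (@cts_eq _ _ (fun x => if (j <= m)%N then f x ord0 (inord j) else 0)).
  by move=> x; rewrite mxE.
by case: (j <= m)%N; [exact: cts_coord | exact: cts_cst].
Qed.

(** Normalizing makes this a point of the sphere for all [m] and [k]. It changes nothing when
    [m <= k]; otherwise coordinates are cut off. *)
Definition pad (m k : nat) (x : sphere R m) : sphere R k :=
  normalize (pad_row k (\val x)).

Lemma val_pad m k (x : sphere R m) : (m <= k)%N ->
  \val (pad k x) = pad_row k (\val x).
Proof.
move=> mk; rewrite val_normalize -?dot_eq0 ?dot_pad_row // ?sphere_dot ?oner_eq0
  //.
by rewrite /euclid dot_pad_row // sphere_dot sqrtr1 invr1 scale1r.
Qed.

Lemma padN m k (x : sphere R m) : (m <= k)%N ->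
  pad k (antipode x) = antipode (pad k x).
Proof.
by move=> mk; apply: val_inj; rewrite /= !val_pad // pad_rowN.
Qed.

Lemma pad_id m (x : sphere R m) : pad m x = x.
Proof.
apply: val_inj; rewrite val_pad //; apply/rowP => j.
by rewrite mxE -ltnS ltn_ord inord_val.
Qed.

Lemma pad_pt m k : (m <= k)%N -> pad k (point : sphere R m) = point.
Proof.
move=> mk; apply: val_inj; rewrite val_pad //; apply/rowP => j; rewrite !mxE
  eqxx /=.
case: leqP => jm; first by rewrite -val_eqE /= inordK.
by rewrite -val_eqE /=; case: j jm => -[].
Qed.

Lemma cts_pad m k (T : topologicalType) (f : T -> sphere R m) : (m <= k)%N ->
  continuous f -> continuous (fun x => pad k (f x)).
Proof.
move=> mk cf; apply: cts_normalize.
  by move=> x; rewrite -dot_eq0 dot_pad_row // sphere_dot oner_eq0.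
by apply: cts_pad_row; exact: cts_sval.
Qed.

(* Moves [x] towards [b], reaching it at [t = 1] on the hemisphere around [b].
  *)
Definition push_row k (b x : sphere R k) (t : R) : 'rV[R]_k.+1 :=
  let s := t * Num.min 1 (1 + dot (\val x) (\val b)) in
  (1 - s) *: \val x + s *: \val b.

Definition push k (b x : sphere R k) (t : R) : sphere R k :=
  normalize (push_row b x t).

(** The segment from [x] to [b] meets 0 only if [x = - b], and there the factor [1 + dot x b] stops
    the motion. With [c = dot x b], the squared norm is split into the part along [x], namely
    [(1 - s * (1 - c)) ^+ 2], and the part orthogonal to [x]. *)
Lemma push_neq0 k (b x : sphere R k) (t : R) : 0 <= t -> t <= 1 ->
  push_row b x t != 0.
Proof.
move=> t0 t1; rewrite /push_row /=; set s := t * _; rewrite -dot_eq0.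
rewrite !(dotDl, dotDr, dotZl, dotZr) !sphere_dot.
rewrite (dotC (\val b)).
have c1 := sphere_dot_le1 x b.
have c2 : -1 <= dot (\val x) (\val b).
  have := sphere_dot_le1 x (antipode b); rewrite /= dotNr; lra.
set c := dot _ _ in c1 c2 s *.
rewrite gt_eqF //.
have s0 : 0 <= s by rewrite mulr_ge0 // le_min; apply/andP; split; lra.
have s1 : s <= 1 + c.
  apply: (@le_trans _ _ (1 * (1 + c))); last by rewrite mul1r.
  by apply: ler_pM => //; [rewrite le_min; apply/andP; split; lra|
    rewrite ge_min lexx orbT].
have s2 : s <= 1.
  rewrite -[leRHS]mulr1; apply: ler_pM => //; last by rewrite ge_min lexx.
  by rewrite le_min; apply/andP; split; lra.
have [c3|c3] := eqVneq c (-1).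
  have -> : s = 0 by apply/le_anti/andP; split=> //; lra.
  lra.
have : -1 < c by rewrite lt_neqAle eq_sym c3.
move=> c4.
rewrite [X in 0 < X](_ : _ =
  (1 - s * (1 - c)) ^+ 2 + s ^+ 2 * (1 - c) * (1 + c)); last by ring.
have [sE|sn] := eqVneq s 0.
  by rewrite [X in 0 < X](_ : _ = 1) ?ltr01 // sE; ring.
have [cE|cn] := eqVneq c 1.
  by rewrite [X in 0 < X](_ : _ = 1) ?ltr01 // cE; ring.
apply: ltr_wpDl; first exact: sqr_ge0.
have sp : 0 < s by rewrite lt_def sn.
have cp : c < 1 by rewrite lt_def eq_sym cn.
by apply: mulr_gt0; [apply: mulr_gt0; [exact: exprn_gt0|lra]|lra].
Qed.

Lemma push0 k (b x : sphere R k) : push b x 0 = x.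
Proof. by rewrite /push /push_row /= mul0r subr0 scale1r scale0r addr0
  normalizeK. Qed.

Lemma push_id k (b : sphere R k) t : push b b t = b.
Proof. by rewrite /push /push_row /= -scalerDl subrK scale1r normalizeK. Qed.

Lemma push1 k (b x : sphere R k) : 0 <= dot (\val x) (\val b) -> push b x 1 = b.
Proof.
move=> c0; rewrite /push /push_row /= (min_idPl _) ?lerDl // mulr1 subrr scale0r
  add0r scale1r.
exact: normalizeK.
Qed.

Lemma pushN k (b x : sphere R k) t : 0 <= t -> t <= 1 ->
  push (antipode b) (antipode x) t = antipode (push b x t).
Proof.
move=> t0 t1; rewrite /push -normalizeN ?push_neq0 //.
by rewrite /push_row /= dotNl dotNr opprK !scalerN -opprD.
Qed.

Lemma cts_push k (T : topologicalType) (b x : T -> sphere R k)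
    (t : T -> unit_interval R) :
  continuous b -> continuous x -> continuous t ->
  continuous (fun z => push (b z) (x z) (\val (t z))).
Proof.
move=> cb cx ct; apply: cts_normalize.
  by move=> z; apply: push_neq0; rewrite ?unit_ge0 ?unit_le1.
have cd : continuous (fun z => dot (\val (x z)) (\val (b z)) : R).
  by apply: cts_dot; exact: cts_sval.
have cv : continuous (fun z => \val (t z) : R) by exact: cts_uval.
by apply: cts_rowD; apply: cts_rowZ; (try exact: cts_sval); cts.
Qed.

End sphere.

Lemma mod_involution_eq (T : ptopologicalType) (a : T -> T) (aK : involutive a)
    (x y : T) :
  \pi_(mod_involution aK) x = \pi_(mod_involution aK) y <-> x = y \/ x = a y.
Proof.
split=> [/eqmodP/orP[/eqP ->|/eqP ->]|xy]; [by left|by right|].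
by apply/eqmodP/orP; case: xy => ->; [left|right].
Qed.

(** * Projective product spaces *)

Section projective_product.
Context {R : realType} {r : nat} (n : 'I_r.+1 -> nat).
Context (n_min : forall i, (n ord0 <= n i)%N).
Local Notation I := (unit_interval R).
Local Notation S := (sphere_product R n).
Local Notation X := (projective_product R n).

Definition pp_pi : S -> X := \pi_X.

Lemma pp_piP (x y : S) : pp_pi x = pp_pi y <-> x = y \/ x = product_antipode y.
Proof. exact: mod_involution_eq. Qed.

Lemma quotient_map_pp : quotient_map pp_pi.
Proof. exact: quotient_map_pi. Qed.

Lemma cts_factor (T : topologicalType) (f : T -> S) k :
  continuous f -> continuous (fun z => f z k).
Proof. exact: cts_proj. Qed.

Lemma continuous_factor k : continuous (fun x : S => x k).
Proof. exact (@cts_factor S (fun x => x) k (@cts_id S)). Qed.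

Lemma cts_sphere_product (T : topologicalType) (f : T -> S) :
  (forall k, continuous (fun z => f z k)) -> continuous f.
Proof. exact: cts_prod. Qed.

Definition section_pt (x : S) (k : 'I_r.+1) : sphere R (n k) := pad (n k) (x
  ord0).

Lemma section_ptN x k :
  section_pt (product_antipode x) k = antipode (section_pt x k).
Proof. exact: padN. Qed.

Lemma section_pt0 x : section_pt x ord0 = x ord0.
Proof. exact: pad_id. Qed.

Lemma cts_section_pt (T : topologicalType) (f : T -> S) k :
  continuous f -> continuous (fun z => section_pt (f z) k).
Proof. by move=> cf; apply: cts_pad => //; exact: cts_factor. Qed.

Definition selected (v : {set 'I_r}) (k : 'I_r.+1) : bool :=
  if unlift ord0 k is Some i then i \in v else false.

Lemma selected0 v : selected v ord0 = false.
Proof. by rewrite /selected unlift_none. Qed.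

Lemma selectedE v i : selected v (lift ord0 i) = (i \in v).
Proof. by rewrite /selected liftK. Qed.

Definition to_section (v : {set 'I_r}) (x : S) : S :=
  fun k => if selected v k then section_pt x k else x k.

Lemma to_section_ord0 v x : to_section v x ord0 = x ord0.
Proof. by rewrite /to_section selected0. Qed.

Lemma section_pt_to_section v x k :
  section_pt (to_section v x) k = section_pt x k.
Proof. by rewrite /section_pt to_section_ord0. Qed.

Lemma to_sectionN v x :
  to_section v (product_antipode x) = product_antipode (to_section v x).
Proof.
apply: functional_extensionality_dep => k.
by rewrite /to_section section_ptN /product_antipode; case: ifP.
Qed.

Lemma to_sectionU v w x :
  to_section v (to_section w x) = to_section (v :|: w) x.
Proof.
apply: functional_extensionality_dep => k.
rewrite {1 3}/to_section section_pt_to_section /to_section /selected.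
by case: unlift => // i; rewrite inE; case: (i \in v).
Qed.

Lemma to_section_pt v : to_section v (point : S) = point.
Proof.
apply: functional_extensionality_dep => k.
by rewrite /to_section /section_pt pad_pt //; case: ifP.
Qed.

Lemma cts_to_section (T : topologicalType) (f : T -> S) v :
  continuous f -> continuous (fun z => to_section v (f z)).
Proof.
move=> cf; apply: cts_sphere_product => k; rewrite /to_section.
by case: (selected v k); [exact: cts_section_pt | exact: cts_factor].
Qed.

Definition product_push (x : S) (t : R) : S :=
  fun k => push (section_pt x k) (x k) t.

Lemma product_push_ord0 x t : product_push x t ord0 = x ord0.
Proof. by rewrite /product_push section_pt0 push_id. Qed.

(** Below 1 exactly where the inner product with the section is positive, which is inside the
    hemisphere where [push] ends on the section. *)
Definition section_dist (i : 'I_r) (x : S) : R :=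
  Num.min 1 (1 - dot (\val (x (lift ord0 i))) (\val (section_pt x (lift ord0
    i)))).

Lemma section_distN i x : section_dist i (product_antipode x) = section_dist i
  x.
Proof. by rewrite /section_dist section_ptN /= dotNl dotNr opprK. Qed.

(** All three constructions commute with the antipode and so descend. Afterwards they are known only
    through these formulas on representatives. *)
Lemma pp_data : exists (e : {set 'I_r} -> X -> X) (H : X * R -> X)
    (l : 'I_r -> X -> R),
  [/\ forall v x, e v (pp_pi x) = pp_pi (to_section v x),
      forall x t, H (pp_pi x, t) = pp_pi (product_push x (\val (clip t))),
      forall i x, l i (pp_pi x) = section_dist i x &
      [/\ forall v, continuous (e v), continuous H & forall i, continuous (l
        i)]].
Proof.
have qX := quotient_map_pp; have [cX _ _] := qX.
have He v : exists e : X -> X, continuous e /\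
    forall x, e (pp_pi x) = pp_pi (to_section v x).
  have [||e ce eE] := quotient_map_descend qX (F := fun x => pp_pi (to_section v
    x)).
  - by apply: cts_comp cX _; apply: cts_to_section; cts.
  - move=> x y /pp_piP[->//|->]; apply/pp_piP; right; exact: to_sectionN.
  by exists e.
have Hl i : exists l : X -> R, continuous l /\
    forall x, l (pp_pi x) = section_dist i x.
  have [||l cl lE] := quotient_map_descend qX (F := section_dist i).
  - apply: cts_min; first exact: cts_cst.
    apply: ctsD; first exact: cts_cst.
    apply: ctsN; apply: cts_dot; apply: cts_sval.
      exact: continuous_factor.
    by apply: cts_section_pt; cts.
  - by move=> x y /pp_piP[->//|->]; exact: section_distN.
  by exists l.
have [e eP] := choice He; have [l lP] := choice Hl.
have [||h ch hE] := quotient_map_descend (quotient_map_unit (R := R) qX)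
    (F := fun z : S * I => pp_pi (product_push z.1 (\val z.2))).
- apply: cts_comp cX _; apply: cts_sphere_product => k.
  apply: cts_push; cts; first by apply: cts_section_pt; cts.
  exact: (@cts_comp _ _ _ fst _ (@continuous_factor k) (@continuous_fst _ _)).
- move=> [x t] [y t'] /= [/pp_piP xy ->]; apply/pp_piP.
  case: xy => ->; [by left|right].
  apply: functional_extensionality_dep => k.
  rewrite {1}/product_push section_ptN; apply: pushN; first exact: unit_ge0.
  exact: unit_le1.
exists e, (fun z => h (z.1, clip z.2)), l; split.
- by move=> v x; have [_ ->] := eP v.
- by move=> x t; rewrite (hE (x, clip t)).
- by move=> i x; have [_ ->] := lP i.
split; [by move=> v; case: (eP v)| |by move=> i; case: (lP i)].
by apply: cts_comp ch _; ctsu.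
Qed.

Context (e : {set 'I_r} -> X -> X) (H : X * R -> X) (l : 'I_r -> X -> R).
Context (eE : forall v x, e v (pp_pi x) = pp_pi (to_section v x)).
Context (HE : forall x t, H (pp_pi x, t) = pp_pi (product_push x (\val (clip
  t)))).
Context (lE : forall i x, l i (pp_pi x) = section_dist i x).

(** A class could also be fixed by exchanging its two representatives, but the retraction leaves the
    coordinate [ord0] alone, and no point of a sphere is its own antipode. *)
Lemma fixed_by_ppE i x : fixed_by e i (pp_pi x) <->
  x (lift ord0 i) = section_pt x (lift ord0 i).
Proof.
rewrite /fixed_by eE; split=> [/eqP/pp_piP[|]|xi].
- move=> /(congr1 (fun y : S => y (lift ord0 i))) <-.
  by rewrite /to_section selectedE finset.in_set1 eqxx.
- move=> /(congr1 (fun y : S => y ord0)); rewrite to_section_ord0.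
  by move/sphere_neqN.
- apply/eqP/pp_piP; left; apply: functional_extensionality_dep => k.
  rewrite /to_section; case: (unliftP ord0 k) => [j ->|->].
    by rewrite selectedE finset.in_set1; case: eqP => // ->.
  by rewrite selected0.
Qed.

Lemma pp_surj (y : X) : exists x, y = pp_pi x.
Proof. by have [_ s _] := quotient_map_pp; have [x <-] := s y; exists x. Qed.

Lemma pp_splitting (ce : forall v, continuous (e v)) (cH : continuous H)
    (cl : forall i, continuous (l i)) :
  exists i : forall u, reduced_suspension R (thom e (~: u) u) ->
      reduced_suspension R X,
    hcoproduct R (fun=> True) i.
Proof.
have ptE : pp_pi point = point by [].
apply: (@thom_splitting R _ X e _ _ _ _ H cH _ _ _ l cl).
- exact: ce.
- move=> y; have [x ->] := pp_surj y; rewrite eE; congr pp_pi.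
  apply: functional_extensionality_dep => k; rewrite /to_section /selected.
  by case: unlift => // i; rewrite finset.in_set0.
- by move=> v w y; have [x ->] := pp_surj y; rewrite !eE to_sectionU.
- by move=> v; rewrite -ptE eE to_section_pt.
- move=> y; have [x ->] := pp_surj y; rewrite HE val_clip //; congr pp_pi.
  by apply: functional_extensionality_dep => k; rewrite /product_push push0.
- move=> t; rewrite -ptE HE; congr pp_pi.
  apply: functional_extensionality_dep => k; rewrite /product_push.
  by rewrite /section_pt pad_pt // push_id.
- move=> i y t; have [x ->] := pp_surj y; rewrite HE => /fixed_by_ppE xi.
  by apply/fixed_by_ppE; rewrite /section_pt product_push_ord0 /product_push
    {1}xi push_id.
- move=> i y; have [x ->] := pp_surj y; rewrite lE /section_dist le_min ler01
  /=.
  by rewrite subr_ge0 sphere_dot_le1.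
- move=> i y; have [x ->] := pp_surj y => /fixed_by_ppE xi.
  rewrite lE /section_dist -xi sphere_dot subrr; apply/min_idPr; exact: ler01.
- move=> i y; have [x ->] := pp_surj y; rewrite lE HE val_clip // => xi.
  apply/fixed_by_ppE; rewrite /section_pt product_push_ord0 /product_push.
  apply: push1; move: xi; rewrite /section_dist gt_min ltxx /=; lra.
Qed.

End projective_product.

(** * Iterated suspensions and stunted projective spaces *)

Section cube.
Context {R : realType}.
Local Notation I := (unit_interval R).
Local Notation Sigma := (reduced_suspension R).

(** Nested in the way [iter] nests suspensions, so that the quotient map onto the iterated
    suspension is built one factor at a time. *)
Fixpoint cube (T : topologicalType) (s : nat) : topologicalType :=
  if s is s'.+1 then (cube T s' * I)%type else T.

Fixpoint cube_base (T : topologicalType) s : cube T s -> T :=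
  if s is s'.+1 then fun z => cube_base z.1 else id.

Fixpoint cube_coord (T : topologicalType) s : cube T s -> nat -> I :=
  if s is s'.+1
  then fun z j => if j == s' then z.2 else cube_coord z.1 j
  else fun _ _ => I0 R.

Fixpoint mk_cube (T : topologicalType) s (x : T) (t : nat -> I) : cube T s :=
  if s is s'.+1 return cube T s then (mk_cube s' x t, t s') else x.

Lemma cube_base_mk (T : topologicalType) s (x : T) t : cube_base (mk_cube s x t)
  = x.
Proof. by elim: s => //= s ->. Qed.

Lemma cube_coord_mk (T : topologicalType) s (x : T) t j : (j < s)%N ->
  cube_coord (mk_cube s x t) j = t j.
Proof.
elim: s => //= s IH; rewrite ltnS leq_eqVlt; case: eqVneq => [->//|_] /=.
exact: IH.
Qed.

Lemma cts_cube_base (T : topologicalType) s : continuous (@cube_base T s).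
Proof.
elim: s => [|s IH] /=; first exact: cts_id.
exact: (cts_comp IH (@continuous_fst _ _)).
Qed.

Lemma cts_cube_coord (T : topologicalType) s j :
  continuous (fun z : cube T s => cube_coord z j).
Proof.
elim: s => [|s IH] /=; first exact: cts_cst.
case: (j == s); first exact: continuous_snd.
exact: (cts_comp IH (@continuous_fst _ _)).
Qed.

Lemma cube_compact (T : topologicalType) s : compact [set: T] ->
  compact [set: cube T s].
Proof.
move=> cT; elim: s => //= s IH.
rewrite -setXTT; apply: compact_setX => //; exact: unit_interval_compact.
Qed.

Context {T : topologicalType} {Y : ptopologicalType} (q : T -> Y).
Context (qq : quotient_map q).

Fixpoint iter_susp (s : nat) : cube T s -> iter s Sigma Y :=
  if s is s'.+1 return cube T s -> iter s Sigma Y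
  then susp_quot (@iter_susp s') else q.

Lemma quotient_map_iter_susp s : quotient_map (@iter_susp s).
Proof. by elim: s => //= s IH; exact: quotient_map_susp. Qed.

Definition degenerate s (z : cube T s) : Prop :=
  q (cube_base z) = point \/
  exists2 j, (j < s)%N & cube_coord z j = I0 R \/ cube_coord z j = I1 R.

Lemma degenerateS s (z : cube T s.+1) : degenerate z <->
  [\/ degenerate z.1, z.2 = I0 R | z.2 = I1 R].
Proof.
split=> [[zp|[j]]|[[zp|[j js zj]]|z0|z1]].
- by apply: Or31; left.
- rewrite ltnS /=; case: eqVneq => [-> _ [] ?|js]; [exact: Or32|exact: Or33|].
  rewrite leq_eqVlt (negbTE js) /= => jls zj.
  by apply: Or31; right; exists j.
- by left.
- by right; exists j => /=; [exact: ltnW|rewrite (ltn_eqF js)].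
- by right; exists s => //=; rewrite eqxx; left.
- by right; exists s => //=; rewrite eqxx; right.
Qed.

(** Both parts go through one induction, since what is collapsed at a stage depends on what already
    is the base point. The result is that the iterated suspension collapses the degenerate points
    all at once. *)
Lemma iter_suspP s : (forall z : cube T s, iter_susp z = point <-> degenerate z)
  /\
  forall z z' : cube T s, iter_susp z = iter_susp z' <->
    (q (cube_base z) = q (cube_base z') /\
      forall j, (j < s)%N -> cube_coord z j = cube_coord z' j) \/
    (degenerate z /\ degenerate z').
Proof.
elim: s => [|s [IHp IH]].
  split=> [z|z z'] /=; first by split=> [|[//|[]//]]; left.
  split=> [->|[[]//|[[->|[]//] [->|[]//]]]]; first by left.
  by [].
have D (z : cube T s.+1) : degenerate z <->
    [\/ iter_susp z.1 = point, z.2 = I0 R | z.2 = I1 R].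
  split=> [/degenerateS[/IHp||]|[/IHp zp|z0|z1]]; try by [exact: Or31|exact:
    Or32|exact: Or33].
  - by apply/degenerateS; exact: Or31.
  - by apply/degenerateS; exact: Or32.
  - by apply/degenerateS; exact: Or33.
have E (z z' : cube T s.+1) : iter_susp z = iter_susp z' <->
    (iter_susp z.1 = iter_susp z'.1 /\ z.2 = z'.2) \/
    (degenerate z /\ degenerate z').
  split=> [/collapse_eq[[zz tt]|[/D d /D d']]|[[a b]|[/D d /D d']]].
  - by left.
  - by right.
  - by apply/collapse_eq; left; congr pair.
  - by apply/collapse_eq; right.
split=> [z|z z'].
  split=> [/collapse_eq[[zp z0]|[d _]]|/D zp]; [|exact/D|].
    by apply/D; exact: Or31.
  by apply/collapse_eq; right; split=> //=; exact: Or31.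
split=> [/E[[/IH H1 z2]|]|[[zb zc]|dd]]; [|by right| |by apply/E; right].
  case: H1 => [[zb zc]|[d d']].
    left; split=> // j; rewrite ltnS leq_eqVlt /=.
    by case: eqVneq => // _ /zc.
  by right; split; apply/degenerateS; exact: Or31.
apply/E; left; split.
  apply/IH; left; split=> // j js; have := zc j (ltnW js) => /=.
  by rewrite (ltn_eqF js).
by have := zc s (ltnSn s); rewrite /= eqxx.
Qed.

Lemma iter_susp_compact s : compact [set: T] -> compact [set: iter s Sigma Y].
Proof.
move=> cT; have [ci si _] := quotient_map_iter_susp s.
rewrite (_ : [set: _] = (@iter_susp s) @` setT); last first.
  by apply/seteqP; split => y // _; have [z <-] := si y; exists z.
by apply: continuous_compact; [exact: continuous_subspaceT | exact:
  cube_compact].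
Qed.

End cube.

Section homeomorphism.
Context {R : realType}.

(** A continuous map from a compact to a Hausdorff space is closed, so the inverse of a bijective
    one is continuous. *)
Lemma compact_bijective_equivalence (X Y : ptopologicalType) (f : X -> Y) :
  compact [set: X] -> hausdorff_space Y -> based_map f -> injective f ->
  (forall y, exists x, f x = y) -> based_homotopy_equivalent R X Y.
Proof.
move=> cX hY bf injf surjf; have [cf fp] := bf.
have [g gK] := choice surjf.
have fK : cancel f g by move=> x; exact/injf/gK.
have bg : based_map g.
  split; last by rewrite -fp fK.
  apply/continuousP => A oA.
  have -> : g @^-1` A = ~` (f @` (~` A)).
    apply/seteqP; split => y /=.
      by move=> gA [x xA xy]; apply: xA; rewrite -(fK x) xy.
    by move=> H; apply: contrapT => gA; apply: H; exists (g y).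
  apply: closed_openC; apply: compact_closed => //.
  apply: continuous_compact; first exact: continuous_subspaceT.
  by apply: (subclosed_compact _ cX) => //; exact: open_closedC.
exists f, g; split => //.
- have -> : g \o f = id by apply/funext.
  by apply: bh_refl; exact: based_map_id.
- have -> : f \o g = id by apply/funext.
  by apply: bh_refl; exact: based_map_id.
Qed.

Lemma hausdorff_separated (T : topologicalType) :
  (forall x y : T, (forall f : T -> R, continuous f -> f x = f y) -> x = y) ->
  hausdorff_space T.
Proof.
move=> sep x y xy; apply: sep => f cf; apply: Rhausdorff => A B Ax By.
by have [z [Az Bz]] := xy _ _ (cf _ _ Ax) (cf _ _ By); exists (f z).
Qed.

Lemma sphere_product_compact (J : eqType) (n : J -> nat) :
  compact [set: sphere_product R n].
Proof.
have := @tychonoff J (fun i => sphere R (n i)) (fun=> setT)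
  (fun i => @sphere_compact R (n i)).
by rewrite (_ : [set f | _] = setT) //; apply/seteqP; split.
Qed.

End homeomorphism.

(** * Stunted projective spaces as quotients of spheres *)

Section stunted.
Context {R : realType} (m k : nat).
Local Notation St := (stunted_projective R m k).

Definition stunted_pi (y : sphere R k) : St :=
  \pi_St (\pi_(real_projective R k) y).

Definition low (y : sphere R k) : Prop :=
  forall i : 'I_k.+1, (m <= i)%N -> \val y ord0 i = 0.

Lemma lowN y : low (antipode y) <-> low y.
Proof.
split=> ly i mi; have := ly i mi; rewrite /= mxE; last by move=> ->; rewrite
  oppr0.
by move/eqP; rewrite oppr_eq0 => /eqP.
Qed.

Lemma sub_projectiveE y :
  @sub_projective R m k (\pi_(real_projective R k) y) <-> low y.
Proof.
split=> [[y' ly' /mod_involution_eq[<-//|E]]|ly]; last by exists y.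
by apply/lowN; rewrite -E.
Qed.

Lemma stunted_piP y y' : stunted_pi y = stunted_pi y' <->
  [\/ y = y', y = antipode y' | low y /\ low y'].
Proof.
split=> [/collapse_eq[/mod_involution_eq[]|[/sub_projectiveE l /sub_projectiveE
  l']]|].
- exact: Or31.
- exact: Or32.
- by apply: Or33.
by case=> [->//|->|[l l']]; apply/collapse_eq;
  [left; apply/mod_involution_eq; right|right; split; apply/sub_projectiveE].
Qed.

Lemma quotient_map_stunted : quotient_map stunted_pi.
Proof.
have q1 : quotient_map (\pi_(real_projective R k) : sphere R k -> _).
  exact: quotient_map_pi.
have q2 : quotient_map (\pi_St : real_projective R k -> _).
  exact: quotient_map_pi.
exact (quotient_map_comp q1 q2).
Qed.

Lemma stunted_pi_pt : stunted_pi point = point.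
Proof. by []. Qed.

(** The products [y_i * y_j] with [m <= i] are even and vanish on the collapsed part, so they
    descend. If some such [y_i] is nonzero, they determine [y] up to sign; if they all vanish, [y]
    lies in the collapsed part. *)
Lemma stunted_hausdorff : hausdorff_space St.
Proof.
apply: (@hausdorff_separated R) => p p'.
have [_ sp _] := quotient_map_stunted.
have [y <-] := sp p; have [y' <-] := sp p' => H.
have E (i j : 'I_k.+1) : (m <= i)%N ->
    \val y ord0 i * \val y ord0 j = \val y' ord0 i * \val y' ord0 j.
  move=> mi; have [||f cf fE] := quotient_map_descend quotient_map_stunted
    (F := fun x : sphere R k => \val x ord0 i * \val x ord0 j : R).
  - by apply: ctsM; apply: cts_coord; apply: cts_sval; cts.
  - move=> x x' /stunted_piP[->//|->|[lx lx']].
      by rewrite /= !mxE mulrNN.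
    by rewrite lx // lx' // !mul0r.
  by rewrite -!fE; exact: H.
apply/stunted_piP.
have [ly|nly] := pselect (low y).
  apply: Or33; split => // i mi; have := E i i mi; rewrite ly // mul0r =>
    /esym/eqP.
  by rewrite mulf_eq0 orbb => /eqP.
have [i /not_implyP[mi /eqP yi]] := (existsNP _).2 nly.
have := E i i mi; rewrite -!expr2 => /eqP; rewrite eqf_sqr => /orP[]/eqP yy'.
- apply: Or31; apply: val_inj; apply/rowP => j; apply: (mulfI yi).
  by rewrite E // yy'.
- apply: Or32; apply: val_inj; apply/rowP => j; apply: (mulfI yi).
  by rewrite E //= mxE yy' mulrNN.
Qed.

End stunted.

(** * The Thom spaces *)

Section coordinates.
Context {R : realType} {r : nat} (n : 'I_r.+1 -> nat) (u : {set 'I_r}).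
Local Notation m := (subtuple_sum n u + #|u|)%N.
Local Notation K := (n ord0 + subtuple_sum n u + #|u|)%N.
Local Notation slot := {i : 'I_r & 'I_(n (lift ord0 i)).+1}.

(* The coordinates of the sphere covering [summand_base R n u]: one block of
   [n i + 1] coordinates for each [i] in [u], followed by a block of
   [n ord0 + 1] coordinates. *)
Definition fiber_slot := {t : slot | tag t \in u}.

Lemma card_fiber_slot : #|{: fiber_slot}| = m.
Proof.
rewrite card_sig -[LHS]sum1_card.
transitivity (\sum_(t : slot | (tag t \in u) && true) 1)%N.
  by apply: eq_bigl => t; rewrite andbT.
rewrite -(sig_big_dep (I := 'I_r) (J := fun i => 'I_(n (lift ord0 i)).+1)
  (fun i => i \in u) (fun=> predT) (fun=> fun=> 1%N)) /=.
rewrite /subtuple_sum -[#|u|]sum1_card -big_split /=; apply: eq_bigr => i _.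
by rewrite sum1_card card_ord addn1.
Qed.

Lemma coord_count : (m + (n ord0).+1 = K.+1)%N.
Proof. by rewrite addnS (addnC _ (n ord0)) addnA. Qed.

(** The fibre coordinates come first because [low] demands that the coordinates from [m] on vanish:
    the collapsed [RP^(m-1)] is then the locus where the base block is zero. *)
Definition lo (t : fiber_slot) : 'I_K.+1 :=
  cast_ord coord_count (lshift _ (cast_ord card_fiber_slot (enum_rank t))).

Definition hi (q : 'I_(n ord0).+1) : 'I_K.+1 := cast_ord coord_count (rshift m
  q).

Lemma lo_lt t : (lo t < m)%N.
Proof. exact: (ltn_ord (cast_ord card_fiber_slot (enum_rank t))). Qed.

Lemma hi_ge q : (m <= hi q)%N. Proof. exact: leq_addr. Qed.

Variant coord_spec : 'I_K.+1 -> Prop :=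
  | CoordLo t : coord_spec (lo t)
  | CoordHi q : coord_spec (hi q).

Lemma coordP p : coord_spec p.
Proof.
rewrite -(cast_ordKV coord_count p); move: (cast_ord (esym coord_count) p) =>
  p'.
case: (splitP p') => j pj.
  have -> : p' = lshift _ j by exact: val_inj.
  have -> : j = cast_ord card_fiber_slot
      (enum_rank (enum_val (cast_ord (esym card_fiber_slot) j))).
    by rewrite enum_valK cast_ordKV.
  exact: CoordLo.
have -> : p' = rshift m j by exact: val_inj.
exact: CoordHi.
Qed.

Definition assemble (d : fiber_slot -> R) (z : 'rV[R]_(n ord0).+1) : 'rV[R]_K.+1
  :=
  \row_p match fintype.split (cast_ord (esym coord_count) p) with
         | inl a => d (enum_val (cast_ord (esym card_fiber_slot) a))
         | inr q => z ord0 q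
         end.

Lemma assemble_lo d z t : assemble d z ord0 (lo t) = d t.
Proof.
rewrite mxE /lo cast_ordK -[lshift _ _]/(unsplit (inl _)) unsplitK.
by rewrite cast_ordK enum_rankK.
Qed.

Lemma assemble_hi d z q : assemble d z ord0 (hi q) = z ord0 q.
Proof.
by rewrite mxE /hi cast_ordK -[rshift _ _]/(unsplit (inr _)) unsplitK.
Qed.

Lemma cts_assemble (T : topologicalType) (d : T -> fiber_slot -> R)
    (z : T -> 'rV[R]_(n ord0).+1) :
  (forall t, continuous (fun x => d x t)) -> continuous z ->
  continuous (fun x => assemble (d x) (z x)).
Proof.
move=> cd cz; apply: cts_row => p; case: (coordP p) => [t|q].
  by apply: cts_eq (@cd t) => x; rewrite assemble_lo.
by apply: cts_eq (cts_coord (j := q) cz) => x; rewrite assemble_hi.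
Qed.

End coordinates.

(** * Chord coordinates on the ball *)

Section fiber_point.
Context {R : realType} {k : nat}.
Implicit Types b x : sphere R k.

(* For fixed [b], [(x, t)] runs through the closed unit ball: [t] is the
   position on the chord from [b] to [x], so that exactly the points with
   [t = 0], [t = 1] or [x = b] lie on the boundary sphere. *)
Definition chord b x (t : R) : 'rV[R]_k.+1 := (1 - t) *: \val b + t *: \val x.

(** For [t] in [0, 1], what is missing to 1 is a product of nonnegative factors whose zeros are the
    three boundary cases [t = 0], [t = 1] and [x = b]. *)
Lemma dot_chord b x t : dot (chord b x t) (chord b x t) =
  1 - 2 * (t * (1 - t) * (1 - dot (\val x) (\val b))).
Proof.
rewrite !(dotDl, dotDr, dotZl, dotZr) !sphere_dot (dotC (\val b)); ring.
Qed.

Lemma chordN b x t : chord (antipode b) (antipode x) t = - chord b x t.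
Proof. by rewrite /chord /= !scalerN -opprD. Qed.

Lemma euclid_chord_le1 b x t : 0 <= t -> t <= 1 -> euclid (chord b x t) <= 1.
Proof.
move=> t0 t1; rewrite -(ler_pXn2r (ltn0Sn 1)) ?nnegrE ?euclid_ge0 //.
rewrite euclid_sqr expr1n dot_chord.
have : 0 <= t * (1 - t) * (1 - dot (\val x) (\val b)).
  by rewrite !mulr_ge0 ?subr_ge0 ?sphere_dot_le1.
lra.
Qed.

Lemma euclid_chord_eq1 b x t : [\/ t = 0, t = 1 | x = b] ->
  euclid (chord b x t) = 1.
Proof.
move=> H; rewrite /euclid dot_chord; have -> : t * (1 - t) * (1 - dot (\val x)
  (\val b)) = 0.
  by case: H => ->; rewrite ?sphere_dot ?subrr ?mul0r ?mulr0 ?mul0r.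
by rewrite mulr0 subr0 sqrtr1.
Qed.

Lemma sphere_dot_lt1 b x : x <> b -> dot (\val x) (\val b) < 1.
Proof.
move=> xb; rewrite lt_neqAle sphere_dot_le1 andbT.
by apply/eqP => /sphere_dot_eq1.
Qed.

Lemma euclid_chord_lt1 b x t : 0 < t -> t < 1 -> x <> b ->
  euclid (chord b x t) < 1.
Proof.
move=> t0 t1 xb; rewrite -(ltr_pXn2r (ltn0Sn 1)) ?nnegrE ?euclid_ge0 //.
rewrite euclid_sqr expr1n dot_chord.
have : 0 < t * (1 - t) * (1 - dot (\val x) (\val b)).
  by rewrite !mulr_gt0 ?subr_gt0 // sphere_dot_lt1.
lra.
Qed.

(** The vector [w = chord b x t - b] is [t *: (x - b)]. Hence [dot w w = 2 * t ^+ 2 * (1 - dot x b)]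
    and [- dot w b = t * (1 - dot x b)], so that [t] is recovered as [dot w w / (- 2 * dot w b)],
    and then [x]. *)
Lemma chord_inj b x x' t t' : 0 < t -> t < 1 -> x <> b ->
  0 < t' -> chord b x t = chord b x' t' -> t = t' /\ x = x'.
Proof.
move=> t0 t1 xb t'0 E.
have A y s : chord b y s - \val b = s *: (\val y - \val b).
  by apply/rowP => j; rewrite !mxE; ring.
have B y s : 1 - dot (chord b y s) (\val b) = s * (1 - dot (\val y) (\val b)).
  by rewrite dotDl !dotZl sphere_dot; ring.
have C (y : sphere R k) : dot (\val y - \val b) (\val y - \val b) = 2 * (1 - dot
  (\val y) (\val b)).
  rewrite !(dotDl, dotDr, dotNl, dotNr) !sphere_dot (dotC (\val b)); ring.
have := B x t; rewrite E B => B'.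
have := congr1 (fun a => dot (a - \val b) (a - \val b)) E.
rewrite /= !A !dotZl !dotZr !C => D.
have c0 : 0 < 1 - dot (\val x) (\val b) by rewrite subr_gt0 sphere_dot_lt1.
have tt' : t = t'.
  have P : 0 < t * (1 - dot (\val x) (\val b)) by exact: mulr_gt0.
  have : t * (t * (1 - dot (\val x) (\val b))) = t' * (t * (1 - dot (\val x)
    (\val b))).
    rewrite -{2}B'; lra.
  by move/(mulIf (lt0r_neq0 P)).
split=> //; apply: val_inj.
have := congr1 (fun a => a - \val b) E; rewrite /= !A tt'.
move=> /(scalerI (lt0r_neq0 t'0)) /(congr1 (fun a => a + \val b)).
by rewrite !subrK.
Qed.

(** The line from [b] through [a] is extended to its second intersection [b + s^-1 *: w] with the
    sphere. Solving for norm 1 gives [s = dot w w / (2 * p)] with [p = - dot w b], and [s < 1]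
    amounts to [dot a a < 1]. *)
Lemma chord_surj b (a : 'rV[R]_k.+1) : euclid a < 1 ->
  exists x t, [/\ 0 < t, t < 1 & chord b x t = a].
Proof.
move=> a1.
have a2 : dot a a < 1.
  by rewrite -euclid_sqr -[ltRHS](expr1n _ 2) ltr_pXn2r ?nnegrE ?euclid_ge0.
set w := a - \val b; have D : dot w w = dot a a - 2 * dot a (\val b) + 1.
  by rewrite !(dotDl, dotDr, dotNl, dotNr) sphere_dot (dotC (\val b)); ring.
have w0 : 0 < dot w w.
  rewrite lt_def dot_ge0 andbT dot_eq0 subr_eq0; apply: contraTneq a2 => ->.
  by rewrite sphere_dot ltxx.
pose p := 1 - dot a (\val b).
have p0 : dot w w < 2 * p by rewrite D /p; lra.
pose s := dot w w / (2 * p).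
have pp : 0 < 2 * p by exact: lt_trans w0 p0.
have s0 : 0 < s by exact: divr_gt0.
have s1 : s < 1 by rewrite ltr_pdivrMr // mul1r.
have sp : s * (2 * p) = dot w w by rewrite divfK // gt_eqF.
have wb : dot w (\val b) = - p by rewrite /w dotDl dotNl sphere_dot /p; ring.
have wE : w = a - \val b by [].
clearbody w.
have xS : dot (\val b + s^-1 *: w) (\val b + s^-1 *: w) = 1.
  rewrite !(dotDl, dotDr, dotZl, dotZr) sphere_dot (dotC (\val b)) wb -sp.
  by field; rewrite gt_eqF.
exists (SigSub (dot_inS xS)), s; split=> //.
rewrite /chord /= scalerDr scalerA divff ?scale1r ?gt_eqF // scalerBl scale1r.
by rewrite addrA subrK wE addrC subrK.
Qed.

End fiber_point.

(** * From products of balls over the base to projective coordinates *)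

Section thom_map.
Context {R : realType} {r : nat} (n : 'I_r.+1 -> nat).
Context (n_min : forall i, (n ord0 <= n i)%N) (u : {set 'I_r}).
Local Notation I := (unit_interval R).
Local Notation S := (sphere_product R n).
Local Notation m := (subtuple_sum n u + #|u|)%N.
Local Notation K := (n ord0 + subtuple_sum n u + #|u|)%N.
Implicit Types (x : S) (t : 'I_r -> I).

Definition ball_coord x t (i : 'I_r) : 'rV[R]_(n (lift ord0 i)).+1 :=
  chord (section_pt x (lift ord0 i)) (x (lift ord0 i)) (\val (t i)).

(** The norm on the fibre whose unit ball is the product of the balls of the single factors. *)
Definition ball_norm x t : R := \big[Num.max/0]_(i in u) euclid (ball_coord x t
  i).

(** Homogeneous coordinates [[v : (1 - N v) z]] of the vector [v] in the fibre over [z], with [N]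
    the norm [ball_norm]. The open ball is stretched over the whole fibre by [v / (1 - N v)], and
    its boundary goes to [RP^(m-1)]. *)
Definition homogeneous x t : 'rV[R]_K.+1 :=
  assemble (fun s : fiber_slot n u => ball_coord x t (tag (val s)) ord0 (tagged
    (val s)))
    ((1 - ball_norm x t) *: \val (x ord0)).

Definition boundary x t i : Prop :=
  [\/ t i = I0 R, t i = I1 R | x (lift ord0 i) = section_pt x (lift ord0 i)].

Lemma ball_norm_ge0 x t : 0 <= ball_norm x t.
Proof. exact: bigmax_ge_id. Qed.

Lemma ball_norm_ge x t i : i \in u -> euclid (ball_coord x t i) <= ball_norm x
  t.
Proof. by move=> iu; rewrite /ball_norm (bigmaxD1 i) //= le_max lexx. Qed.

Lemma ball_norm_le1 x t : ball_norm x t <= 1.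
Proof.
apply/bigmax_leP; split=> // i _.
by apply: euclid_chord_le1; [exact: unit_ge0|exact: unit_le1].
Qed.

Lemma ball_norm_eq1 x t i : i \in u -> boundary x t i -> ball_norm x t = 1.
Proof.
move=> iu ib; apply/le_anti/andP; split; first exact: ball_norm_le1.
have <- : euclid (ball_coord x t i) = 1; last exact: ball_norm_ge.
apply: euclid_chord_eq1.
by case: ib => [->|->|->]; [exact: Or31|exact: Or32|exact: Or33].
Qed.

Lemma interior_coord x t i : ~ boundary x t i ->
  [/\ 0 < \val (t i), \val (t i) < 1 &
      x (lift ord0 i) <> section_pt x (lift ord0 i)].
Proof.
move=> nb; split.
- rewrite lt_def unit_ge0 andbT; apply/eqP => t0; apply: nb; apply: Or31.
  by apply: val_inj; rewrite t0.
- rewrite lt_def unit_le1 andbT; apply/eqP => t1; apply: nb; apply: Or32.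
  by apply: val_inj; rewrite -t1.
- by move=> xi; apply: nb; exact: Or33.
Qed.

Lemma ball_norm_lt1 x t : (forall i, i \in u -> ~ boundary x t i) ->
  ball_norm x t < 1.
Proof.
move=> nb; apply/bigmax_ltP; split=> // i /nb /interior_coord[t0 t1 xi].
exact: euclid_chord_lt1.
Qed.

Lemma homogeneous_lo x t (s : fiber_slot n u) : homogeneous x t ord0 (lo s) =
  ball_coord x t (tag (val s)) ord0 (tagged (val s)).
Proof. exact: assemble_lo. Qed.

Lemma homogeneous_hi x t q : homogeneous x t ord0 (hi u q) =
  (1 - ball_norm x t) * \val (x ord0) ord0 q.
Proof. by rewrite assemble_hi mxE. Qed.

Lemma homogeneous_block x t i (iu : i \in u) (c : R) x' t' :
  (forall s : fiber_slot n u,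
     homogeneous x t ord0 (lo s) = c * homogeneous x' t' ord0 (lo s)) ->
  ball_coord x t i = c *: ball_coord x' t' i.
Proof.
move=> E; apply/rowP => j; rewrite [RHS]mxE.
have := E (exist _ (Tagged (fun i => 'I_(n (lift ord0 i)).+1) j) iu).
by rewrite !homogeneous_lo.
Qed.

Lemma homogeneous_neq0 x t : homogeneous x t != 0.
Proof.
apply/eqP => F.
have d0 i : i \in u -> ball_coord x t i = 0.
  move=> iu; rewrite -(scale0r (ball_coord x t i)); apply: homogeneous_block =>
    // s.
  by rewrite F mxE mul0r.
have N0 : ball_norm x t = 0.
  apply/le_anti; rewrite ball_norm_ge0 andbT; apply/bigmax_leP; split=> // i iu.
  by rewrite d0 // -[0 : 'rV_ _](scale0r (\val (point : sphere R _))) euclidZ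
    normr0 mul0r.
have /eqP := sphere_neq0 (x ord0); apply; apply/rowP => q.
by have := homogeneous_hi x t q; rewrite F N0 !mxE subr0 mul1r => <-.
Qed.

Lemma homogeneous_low x t : low m (normalize (homogeneous x t)) <-> ball_norm x
  t = 1.
Proof.
have F0 := homogeneous_neq0 x t.
have e0 : (euclid (homogeneous x t))^-1 != 0.
  by rewrite invr_eq0 gt_eqF // euclid_gt0.
have E p : \val (normalize (homogeneous x t)) ord0 p =
    (euclid (homogeneous x t))^-1 * homogeneous x t ord0 p.
  by rewrite val_normalize // mxE.
split=> [l|N1 p].
  apply: contrapT => /eqP N1; have /eqP := sphere_neq0 (x ord0); apply.
  apply/rowP => q; have := l (hi u q) (hi_ge u q).
  rewrite E homogeneous_hi => /eqP; rewrite !mulf_eq0 (negbTE e0) /= subr_eq0.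
  by rewrite eq_sym (negbTE N1) /= mxE => /eqP.
rewrite E; case: (coordP p) => [s|q _].
  by rewrite leqNgt lo_lt.
by rewrite homogeneous_hi N1 subrr mul0r mulr0.
Qed.

Lemma ball_coordN x t i :
  ball_coord (product_antipode x) t i = - ball_coord x t i.
Proof. by rewrite /ball_coord section_ptN // chordN. Qed.

Lemma ball_normN x t : ball_norm (product_antipode x) t = ball_norm x t.
Proof. by apply: eq_bigr => i _; rewrite ball_coordN euclidN. Qed.

Lemma homogeneousN x t : homogeneous (product_antipode x) t = - homogeneous x t.
Proof.
apply/rowP => p; rewrite [in RHS]mxE; case: (coordP p) => [s|q].
  by rewrite !homogeneous_lo ball_coordN mxE.
by rewrite !homogeneous_hi ball_normN /= mxE mulrN.
Qed.

Lemma to_section_eq x x' : to_section (~: u) x = to_section (~: u) x' <->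
  x ord0 = x' ord0 /\ forall i, i \in u -> x (lift ord0 i) = x' (lift ord0 i).
Proof.
split=> [E|[x0 xi]].
  split; first by have := congr1 (fun y : S => y ord0) E; rewrite
    !to_section_ord0.
  move=> i iu; have := congr1 (fun y : S => y (lift ord0 i)) E.
  by rewrite /to_section selectedE inE iu.
apply: functional_extensionality_dep => k; rewrite /to_section /section_pt x0.
case: (unliftP ord0 k) => [i ->|->]; last by rewrite selected0.
by rewrite selectedE inE; case: (boolP (i \in u)) => // /xi.
Qed.

Lemma homogeneous_eq x t x' t' : to_section (~: u) x = to_section (~: u) x' ->
  (forall i, i \in u -> t i = t' i) -> homogeneous x t = homogeneous x' t'.
Proof.
move=> /to_section_eq[x0 xi] tt'.
have d i : i \in u -> ball_coord x t i = ball_coord x' t' i.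
  by move=> iu; rewrite /ball_coord /section_pt x0 xi // tt'.
have N : ball_norm x t = ball_norm x' t'.
  by apply: eq_bigr => i iu; rewrite d.
apply/rowP => p; case: (coordP p) => [s|q].
  by rewrite !homogeneous_lo d //; case: s.
by rewrite !homogeneous_hi N x0.
Qed.

(** Equal normalizations mean proportionality with some [c > 0]. The fibre blocks give [N = c * N'],
    the base block gives [1 - N = c * (1 - N')], and adding these yields [c = 1]; then chords are
    injective factor by factor. *)
Lemma homogeneous_inj x t x' t' :
  (forall i, i \in u -> ~ boundary x t i) ->
  (forall i, i \in u -> ~ boundary x' t' i) ->
  normalize (homogeneous x t) = normalize (homogeneous x' t') ->
  to_section (~: u) x = to_section (~: u) x' /\ (forall i, i \in u -> t i = t'
    i).
Proof.
move=> nb nb' /(congr1 (fun y : sphere R K => \val y)).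
rewrite !val_normalize ?homogeneous_neq0 //.
set a := euclid _; set a' := euclid _ => E.
have a0 : 0 < a by rewrite euclid_gt0 homogeneous_neq0.
have a'0 : 0 < a' by rewrite euclid_gt0 homogeneous_neq0.
pose c := a / a'; have c0 : 0 < c by exact: divr_gt0.
have F : homogeneous x t = c *: homogeneous x' t'.
  by rewrite /c -scalerA -E scalerA divff ?scale1r // gt_eqF.
have d i : i \in u -> ball_coord x t i = c *: ball_coord x' t' i.
  by move=> iu; apply: homogeneous_block => // s; rewrite F mxE.
have N : ball_norm x t = c * ball_norm x' t'.
  rewrite /ball_norm (big_morph (fun y => c * y) (id1 := 0) (op1 := Num.max)).
  - by apply: eq_bigr => i iu; rewrite d // euclidZ gtr0_norm.
  - by move=> y z /=; rewrite maxr_pMr // ltW.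
  - by rewrite mulr0.
have N1 := ball_norm_lt1 nb; have N1' := ball_norm_lt1 nb'.
have z : (1 - ball_norm x t) *: \val (x ord0) =
    (c * (1 - ball_norm x' t')) *: \val (x' ord0).
  apply/rowP => q; rewrite [LHS]mxE [RHS]mxE -homogeneous_hi F mxE.
  by rewrite homogeneous_hi mulrA.
have zN : 1 - ball_norm x t = c * (1 - ball_norm x' t').
  have := congr1 euclid z; rewrite !euclidZ !sphere_euclid !mulr1.
  by rewrite gtr0_norm ?subr_gt0 // gtr0_norm // mulr_gt0 // subr_gt0.
have c1 : c = 1 by rewrite N in zN; lra.
have x0 : x ord0 = x' ord0.
  apply: val_inj; move: z; rewrite -zN; apply: scalerI.
  by rewrite subr_eq0 eq_sym lt_eqF.
have xt i : i \in u -> t i = t' i /\ x (lift ord0 i) = x' (lift ord0 i).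
  move=> iu; have := d i iu; rewrite c1 scale1r /ball_coord /section_pt x0.
  have [t0 t1 xi] := interior_coord (nb i iu).
  have [t'0 _ _] := interior_coord (nb' i iu).
  rewrite /section_pt x0 in xi.
  move=> /(chord_inj t0 t1 xi t'0)[tt ->]; split => //; exact: val_inj.
split; last by move=> i /xt[].
by apply/to_section_eq; split=> // i /xt[].
Qed.

Lemma homogeneous_surj (y : sphere R K) : ~ low m y ->
  exists x t, normalize (homogeneous x t) = y.
Proof.
move=> nl.
pose z : 'rV[R]_(n ord0).+1 := \row_q \val y ord0 (hi u q).
have z0 : 0 < euclid z.
  rewrite euclid_gt0; apply/eqP => z0; apply: nl => p.
  case: (coordP p) => [s|q _]; first by rewrite leqNgt lo_lt.
  by have := congr1 (fun a : 'rV[R]__ => a ord0 q) z0; rewrite !mxE.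
(* The block of [y] at [i], or 0 if [i] is not in [u]. This default lets [chord_surj] be applied to
   all factors uniformly. *)
pose entry (i : 'I_r) (j : nat) : R :=
  if insub (@Tagged 'I_r i (fun i => 'I_(n (lift ord0 i)).+1) (inord j)) is
    Some s then \val y ord0 (lo (s : fiber_slot n u)) else 0.
pose C (k : 'I_r.+1) : 'rV[R]_(n k).+1 :=
  \row_(j < (n k).+1) (if unlift ord0 k is Some i then entry i (val j) else 0).
have CE (s : fiber_slot n u) :
    C (lift ord0 (tag (val s))) ord0 (tagged (val s)) = \val y ord0 (lo s).
  rewrite mxE liftK /entry inord_val.
  by rewrite (_ : Tagged _ (tagged (val s)) = val s) ?valK //; case: s => -[].
have C0 i : i \notin u -> C (lift ord0 i) = 0.
  move=> iu; apply/rowP => j; rewrite !mxE liftK /entry insubF //=.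
  exact/negbTE.
have C00 : C ord0 = 0 by apply/rowP => j; rewrite !mxE unlift_none.
pose NC : R := \big[Num.max/0]_(i in u) euclid (C (lift ord0 i)).
have NC0 : 0 <= NC by exact: bigmax_ge_id.
(* The scale is forced by requiring both [N = NC / D] and [1 - N = euclid z / D]; the homogeneous
   coordinates then come out as [y / D]. *)
pose D := euclid z + NC.
have D0 : 0 < D by rewrite /D; lra.
have euclid0 k : euclid (0 : 'rV[R]_k) = 0.
  by rewrite -(scale0r 0) euclidZ normr0 mul0r.
have Cle k : euclid (C k) <= NC.
  case: (unliftP ord0 k) => [i ->|->]; last by rewrite C00 euclid0.
  case: (boolP (i \in u)) => [iu|/C0 ->]; last by rewrite euclid0.
  by rewrite /NC (bigmaxD1 i) //= le_max lexx.
pose x0 := normalize z.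
have z00 : z != 0 by rewrite -euclid_gt0.
have euclid_lt k : euclid (D^-1 *: C k) < 1.
  rewrite euclidZ gtr0_norm ?invr_gt0 // mulrC ltr_pdivrMr // mul1r.
  by apply: (le_lt_trans (Cle k)); rewrite /D; lra.
have [xs xsP] := dependent_family_choice
  (fun k => chord_surj (pad (n k) x0) (euclid_lt k)).
have [ts tsP] := choice xsP.
(* At [k = ord0] padding is the identity; it gives [x0] the type required at [k] without a
   transport. *)
pose x : S := fun k => if k == ord0 then pad (n k) x0 else xs k.
pose t (i : 'I_r) := clip (ts (lift ord0 i)).
have xx0 : x ord0 = x0 by rewrite /x eqxx pad_id.
have bE i : ball_coord x t i = D^-1 *: C (lift ord0 i).
  have [t0 t1 <-] := tsP (lift ord0 i).
  rewrite /ball_coord /section_pt xx0 /x [lift _ _ == _]eq_sym.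
  by rewrite (negbTE (neq_lift _ _)) val_clip // ltW.
have nE : ball_norm x t = D^-1 * NC.
  rewrite /NC (big_morph (fun y => D^-1 * y) (id1 := 0) (op1 := Num.max)).
  - by apply: eq_bigr => i iu; rewrite bE euclidZ gtr0_norm ?invr_gt0.
  - by move=> a b /=; rewrite maxr_pMr // invr_ge0 ltW.
  - by rewrite mulr0.
have DN0 : D != 0 by rewrite gt_eqF.
exists x, t.
rewrite (_ : homogeneous x t = D^-1 *: \val y).
  by rewrite normalizeZ // invr_gt0.
apply/rowP => p; rewrite [RHS]mxE; case: (coordP p) => [s|q].
  by rewrite homogeneous_lo bE -CE mxE.
rewrite homogeneous_hi nE xx0 /x0 val_normalize // mxE.
rewrite (_ : 1 - D^-1 * NC = D^-1 * euclid z); last first.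
  by rewrite /D; field; rewrite gt_eqF //; rewrite /D in D0.
by rewrite -!mulrA mulVKf ?gt_eqF // mxE.
Qed.

(** The suspension coordinates are matched with the elements of [u] by rank. For [i] outside [u] the
    index is out of range and the value is [I0]. *)
Definition angles (c : @cube R S #|u|) (i : 'I_r) : I := cube_coord c (index i
  (enum u)).

Lemma index_enum_lt i : i \in u -> (index i (enum u) < #|u|)%N.
Proof. by move=> iu; rewrite cardE index_mem mem_enum. Qed.

Definition thom_map (c : @cube R S #|u|) : stunted_projective R m K :=
  stunted_pi m (normalize (homogeneous (cube_base c) (angles c))).

Lemma cts_thom_map : continuous thom_map.
Proof.
have [cs _ _] := @quotient_map_stunted R m K.
have cx k : continuous (fun c : @cube R S #|u| => cube_base c k).
  exact (cts_factor (f := @cube_base R S #|u|) (k := k) (@cts_cube_base R S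
    #|u|)).
have cb i : continuous (fun c : @cube R S #|u| =>
    ball_coord (cube_base c) (angles c) i).
  have ca : continuous (fun c : @cube R S #|u| => \val (angles c i) : R).
    by apply: cts_uval; exact: cts_cube_coord.
  rewrite /ball_coord /chord; apply: cts_rowD; apply: cts_rowZ.
  - by apply: ctsD; [exact: cts_cst | exact: ctsN].
  - by apply: cts_sval; apply: cts_section_pt => //; exact: cts_cube_base.
  - exact: ca.
  - exact: cts_sval.
apply: cts_comp cs _; apply: cts_normalize.
  by move=> c; exact: homogeneous_neq0.
apply: cts_assemble.
  by move=> s; apply: cts_coord.
apply: cts_rowZ; last exact: cts_sval.
apply: ctsD; first exact: cts_cst.
by apply: ctsN; apply: cts_big => [? ?|i _]; [exact: cts_max|]; apply:
  cts_euclid.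
Qed.

End thom_map.

Section equivalences.
Context {R : realType}.
Implicit Types X Y : ptopologicalType.
Local Notation Sigma := (reduced_suspension R).

Lemma bhe_refl X : based_homotopy_equivalent R X X.
Proof.
exists id, id; split; try exact: (based_map_id X).
  exact: (bh_refl (R := R) (based_map_id X)).
exact: (bh_refl (R := R) (based_map_id X)).
Qed.

Lemma susp_map_homotopic X Y (f g : X -> Y) (f' g' : Sigma X -> Sigma Y) :
  (forall x r, f' (susp x r) = susp (f x) r) ->
  (forall x r, g' (susp x r) = susp (g x) r) ->
  based_homotopic R f g -> based_homotopic R f' g'.
Proof.
move=> f'E g'E /bh_real[K [cK K0 K1 Kp]].
apply: (@susp_homotopy _ _ _ _ id _ _ (fun z => susp (K (z.1.1, z.2)) z.1.2)).
- exact: quotient_map_id.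
- by apply: cts_susp; [apply: cts_comp cK _; cts | cts].
- by move=> x r _ _ /=; rewrite K0.
- by move=> x r _ _ /=; rewrite K1.
- by move=> x s _ _ /=; rewrite susp_le0.
- by move=> x s _ _ /=; rewrite susp_ge1.
- by move=> x y r s _ _ _ _ /= ->.
- by move=> x r s _ _ _ _ /= ->; rewrite Kp susp_pt.
Qed.

Lemma bhe_susp X Y : based_homotopy_equivalent R X Y ->
  based_homotopy_equivalent R (Sigma X) (Sigma Y).
Proof.
move=> [f [g [bf bg gf fg]]].
have [f' bf' f'E] := susp_map (R := R) bf.
have [g' bg' g'E] := susp_map (R := R) bg.
exists f', g'; split => //.
- by apply: susp_map_homotopic gf => x r //=; rewrite f'E g'E.
- by apply: susp_map_homotopic fg => x r //=; rewrite g'E f'E.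
Qed.

End equivalences.

(** * The iterated suspension of the Thom space is a stunted projective space *)

Section leaf.
Context {R : realType} {r : nat} (n : 'I_r.+1 -> nat).
Context (n_min : forall i, (n ord0 <= n i)%N) (u : {set 'I_r}).
Local Notation I := (unit_interval R).
Local Notation S := (sphere_product R n).
Local Notation X := (projective_product R n).
Local Notation m := (subtuple_sum n u + #|u|)%N.
Local Notation K := (n ord0 + subtuple_sum n u + #|u|)%N.
Local Notation C := (@cube R S #|u|).
Local Notation Sigma := (reduced_suspension R).
Context (e : {set 'I_r} -> X -> X).
Context (eE : forall v x, e v (pp_pi x) = pp_pi (to_section v x)).

Definition leaf_pi (x : S) : thom e (~: u) u := thom_pi e (~: u) u (pp_pi x).

Lemma quotient_map_leaf : quotient_map leaf_pi.
Proof.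
exact (quotient_map_comp (@quotient_map_pp R r n) (quotient_map_thom e (~: u)
  u)).
Qed.

Definition meets_section (x : S) : Prop :=
  exists2 i, i \in u & x (lift ord0 i) = section_pt x (lift ord0 i).

Lemma fixed_by_some_leaf x :
  fixed_by_some e u (e (~: u) (pp_pi x)) <-> meets_section x.
Proof.
have E i : i \in u -> to_section (~: u) x (lift ord0 i) = x (lift ord0 i).
  by move=> iu; rewrite /to_section selectedE inE iu.
rewrite eE; split=> [/exists_inP[i iu /(fixed_by_ppE eE)]|[i iu xi]].
  by rewrite section_pt_to_section E // => xi; exists i.
apply/exists_inP; exists i => //; apply/(fixed_by_ppE eE).
by rewrite section_pt_to_section E.
Qed.

Lemma leaf_piP x x' : leaf_pi x = leaf_pi x' <->
  [\/ to_section (~: u) x = to_section (~: u) x',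
      to_section (~: u) x = to_section (~: u) (product_antipode x') |
      meets_section x /\ meets_section x'].
Proof.
rewrite to_sectionN //; split.
  move=> /thom_piP[|[/fixed_by_some_leaf k /fixed_by_some_leaf k']].
    by rewrite !eE => /pp_piP[E|E]; [exact: Or31|exact: Or32].
  exact: Or33.
move=> H; apply/thom_piP; rewrite !eE; case: H => [E|E|[k k']].
- by left; rewrite E.
- by left; apply/pp_piP; right.
- by right; rewrite -!eE; split; apply/fixed_by_some_leaf.
Qed.

Lemma section_pt_pt k : section_pt (point : S) k = point.
Proof. exact: pad_pt. Qed.

(** The base point is the first coordinate vector, which lies in the collapsed part as soon as that
    is nonempty. For [m = 0] nothing is collapsed, which is why an empty [u] is treated apart
    below. *)
Lemma point_low : (0 < m)%N -> low m (point : sphere R K).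
Proof.
move=> m0 p mp; rewrite mxE eqxx /=; case: eqP => // p0.
by move: mp; rewrite p0 leqNgt m0.
Qed.

Lemma thom_map_low (c : C) (i : 'I_r) : i \in u ->
  low m (normalize (homogeneous u (cube_base c) (angles c))) -> thom_map c =
    point.
Proof.
move=> iu lc; rewrite -(stunted_pi_pt m K); apply/stunted_piP; apply: Or33;
  split=> //.
by apply: point_low; rewrite addn_gt0 orbC (cardD1 i) iu.
Qed.

Lemma boundary_low (x : S) (t : 'I_r -> I) :
  low m (normalize (homogeneous u x t)) <-> exists2 i, i \in u & boundary x t i.
Proof.
split=> [/homogeneous_low l|[i iu ib]]; last first.
  by apply/homogeneous_low; exact: ball_norm_eq1 ib.
apply: contrapT => nb; move: (l); apply/eqP; rewrite lt_eqF //.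
by apply: ball_norm_lt1 => i iu ib; apply: nb; exists i.
Qed.

Lemma thom_map_boundary (c : C) i : i \in u ->
  boundary (cube_base c) (angles c) i -> thom_map c = point.
Proof. by move=> iu ib; apply: (thom_map_low iu); apply/boundary_low; exists i.
  Qed.

Lemma coord_angle (c : C) j : (j < #|u|)%N ->
  exists2 i, i \in u & angles c i = cube_coord c j.
Proof.
move=> ju; exists (enum_val (Ordinal ju)); first exact: enum_valP.
by rewrite /angles /enum_val index_uniq -?cardE ?enum_uniq.
Qed.

Lemma thom_map_eq (c c' : C) :
  to_section (~: u) (cube_base c) = to_section (~: u) (cube_base c') \/
  to_section (~: u) (cube_base c) =
    to_section (~: u) (product_antipode (cube_base c')) ->
  (forall i, i \in u -> angles c i = angles c' i) -> thom_map c = thom_map c'.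
Proof.
move=> E tt; rewrite /thom_map; case: E => E; rewrite (homogeneous_eq E tt) //.
rewrite homogeneousN // normalizeN ?homogeneous_neq0 //.
by apply/stunted_piP; exact: Or32.
Qed.

Lemma empty_dim : u = finset.set0 -> m = 0%N.
Proof.
by move=> u0; rewrite /subtuple_sum u0 cards0 big_pred0 // => i; rewrite inE.
Qed.

Lemma thom_map_pt (c : C) : cube_base c = point -> thom_map c = point.
Proof.
move=> cp; have [u0|[i iu]] := set_0Vmem u; last first.
  apply: (thom_map_boundary iu); rewrite cp; apply: Or33.
  by rewrite section_pt_pt.
rewrite -(stunted_pi_pt m K) /thom_map cp; congr (stunted_pi m _).
rewrite -[RHS]normalizeK; congr normalize.
have N0 (t : 'I_r -> I) : ball_norm u (point : S) t = 0.
  by rewrite /ball_norm big_pred0 // => i; rewrite u0 inE.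
apply/rowP => p; case: (coordP p) => [s|q].
  have : tag (val s) \in u := valP s.
  by move: (tag (val s)) => i; rewrite {1}u0 inE.
rewrite homogeneous_hi N0 subr0 mul1r !mxE !eqxx /=; congr (_%:R).
by rewrite -!val_eqE /= (empty_dim u0).
Qed.

Lemma thom_map_degenerate (c : C) : degenerate leaf_pi c -> thom_map c = point.
Proof.
case=> [|[j ju cj]]; last first.
  have [i iu ij] := coord_angle c ju.
  apply: (thom_map_boundary iu); rewrite /boundary ij.
  by case: cj => ->; [exact: Or31|exact: Or32].
(* Being the base point in the Thom space determines a representative only up to sign and up to the
   factors outside [u], or else it meets a section. In the first case [c] is compared with the cube
   point that has the same angles over the actual base point. *)
pose c0 : C := mk_cube #|u| (point : S) (cube_coord c).
have c0b : cube_base c0 = point by exact: cube_base_mk.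
have c0t i : i \in u -> angles c i = angles c0 i.
  by move=> iu; rewrite /angles cube_coord_mk // index_enum_lt.
rewrite -[point]/(leaf_pi point) => /leaf_piP[E|E|[[i iu xi] _]].
- by rewrite -(thom_map_pt c0b); apply: thom_map_eq => //; rewrite c0b; left.
- by rewrite -(thom_map_pt c0b); apply: thom_map_eq => //; rewrite c0b; right.
- by apply: (thom_map_boundary iu); exact: Or33.
Qed.

Lemma boundary_degenerate (c : C) i : i \in u ->
  boundary (cube_base c) (angles c) i -> degenerate leaf_pi c.
Proof.
move=> iu; case=> [ti|ti|xi].
- by right; exists (index i (enum u)); [exact: index_enum_lt|left].
- by right; exists (index i (enum u)); [exact: index_enum_lt|right].
- left; rewrite -[point]/(leaf_pi point); apply/leaf_piP; apply: Or33.
  by split; exists i => //; rewrite section_pt_pt.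
Qed.

Lemma antipode_inj k : injective (@antipode R k).
Proof. exact: (can_inj (@antipodeK R k)). Qed.

Lemma boundaryN (x : S) (t : 'I_r -> I) i :
  boundary (product_antipode x) t i -> boundary x t i.
Proof.
case=> [ti|ti|]; [exact: Or31|exact: Or32|].
by rewrite section_ptN // => /antipode_inj xi; exact: Or33.
Qed.

Lemma thom_map_inj (c c' : C) : thom_map c = thom_map c' ->
  iter_susp leaf_pi c = iter_susp leaf_pi c'.
Proof.
have [_ sP] := iter_suspP (R := R) leaf_pi #|u|.
move=> E; apply/sP.
have [[i iu ib]|nb] := pselect (exists2 i, i \in u &
    boundary (cube_base c) (angles c) i).
  right; split; first exact: boundary_degenerate ib.
  have lc : low m (normalize (homogeneous u (cube_base c) (angles c))).
    by apply/boundary_low; exists i.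
  have : low m (normalize (homogeneous u (cube_base c') (angles c'))).
    case/stunted_piP: E => [<- //|E|[] //].
    by apply/lowN; rewrite -E.
  by move=> /boundary_low[j ju jb]; exact: boundary_degenerate jb.
have nb' : ~ exists2 i, i \in u & boundary (cube_base c') (angles c') i.
  move=> /boundary_low l'; apply: nb; apply/boundary_low.
  by case/stunted_piP: E => [-> //|->|[] //]; apply/lowN.
have coords : (forall i, i \in u -> angles c i = angles c' i) ->
    forall j, (j < #|u|)%N -> cube_coord c j = cube_coord c' j.
  move=> tt j ju; have := tt _ (enum_valP (Ordinal ju)).
  by rewrite /angles /enum_val index_uniq -?cardE ?enum_uniq.
left; case/stunted_piP: E => [E|E|[/boundary_low //]].
- have [||xx tt] := homogeneous_inj _ _ E.
  + by move=> i iu ib; apply: nb; exists i.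
  + by move=> i iu ib; apply: nb'; exists i.
  by split; [apply/leaf_piP; exact: Or31|exact: coords].
(* The sign is absorbed by replacing the base of [c'] by its antipode, which represents the same
   point. *)
- rewrite -normalizeN ?homogeneous_neq0 // -homogeneousN // in E.
  have [||xx tt] := homogeneous_inj _ _ E.
  + by move=> i iu ib; apply: nb; exists i.
  + by move=> i iu /boundaryN ib; apply: nb'; exists i.
  by split; [apply/leaf_piP; exact: Or32|exact: coords].
Qed.

Lemma thom_map_surj y : exists c : C, thom_map c = y.
Proof.
have [_ sy _] := @quotient_map_stunted R m K; have [y' <-] := sy y.
have [l|nl] := pselect (low m y').
  have [u0|[i iu]] := set_0Vmem u.
    have /eqP := sphere_neq0 y'; case; apply/rowP => p; rewrite mxE l //.
    by rewrite (empty_dim u0).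
  exists (mk_cube #|u| (point : S) (fun=> I0 R)).
  apply/stunted_piP; apply: Or33; split=> //; apply/boundary_low; exists i =>
    //.
  by apply: Or33; rewrite cube_base_mk section_pt_pt.
have [x [t xt]] := homogeneous_surj nl.
pose s j := if insub j is Some j' then t (enum_val (j' : 'I_#|u|)) else I0 R.
exists (mk_cube #|u| x s); rewrite /thom_map -xt cube_base_mk.
congr (stunted_pi m (normalize _)); apply: homogeneous_eq => // i iu.
have iu' := index_enum_lt iu.
rewrite /angles cube_coord_mk // /s insubT /=; congr t.
by rewrite /enum_val nth_index // mem_enum.
Qed.

(** [thom_map] has the same fibres as the quotient map from the cube onto the iterated suspension,
    and it is onto. The induced map is a continuous bijection from a compact space to a Hausdorff
    space. *)
Lemma leaf_desuspension : based_homotopy_equivalent R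
  (iter #|u| Sigma (thom e (~: u) u)) (stunted_projective R m K).
Proof.
have qq := quotient_map_iter_susp (R := R) quotient_map_leaf #|u|.
have [dP sP] := iter_suspP (R := R) leaf_pi #|u|.
have [_ ss _] := qq.
have [|f cf fE] := quotient_map_descend qq (cts_thom_map n_min (u := u)).
  move=> c c' /sP[[/leaf_piP E tt]|[d d']]; last by rewrite
    !thom_map_degenerate.
  have tt' i : i \in u -> angles c i = angles c' i.
    by move=> iu; exact/tt/index_enum_lt.
  case: E => [E|E|[[i iu xi] [i' iu' xi']]].
  - by apply: thom_map_eq => //; left.
  - by apply: thom_map_eq => //; right.
  - rewrite (thom_map_boundary iu); last exact: Or33.
    by rewrite (thom_map_boundary iu') //; exact: Or33.
apply: (@compact_bijective_equivalence R _ _ f).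
- exact (@iter_susp_compact R _ _ leaf_pi quotient_map_leaf #|u|
  (@sphere_product_compact R _ n)).
- exact: stunted_hausdorff.
- split=> //; have [c cp] := ss point; rewrite -cp fE.
  by apply: thom_map_degenerate; apply/dP.
- move=> y y'; have [c <-] := ss y; have [c' <-] := ss y'.
  by rewrite !fE; exact: thom_map_inj.
- by move=> y; have [c <-] := thom_map_surj y; exists (iter_susp leaf_pi c).
Qed.

End leaf.

Theorem theorem2p9 (R : realType) (r : nat) (n : 'I_r.+1 -> nat)
    (n_gt0 : forall i, (0 < n i)%N)
    (n_min : forall i, (n ord0 <= n i)%N) :
  exists D : {set 'I_r} -> ptopologicalType,
    (forall u : {set 'I_r}, (1 < #|u|)%N ->
       is_desuspension R (#|u| - 1)%N (D u) (summand_base R n u)) /\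
    based_homotopy_equivalent R
      (reduced_suspension R (projective_product R n)) (pwedge (summand R n D)).
Proof.
have [e [H [l [eE HE lE [ce cH cl]]]]] := pp_data (R := R) n_min.
(* The summand produced by the splitting is already suspended once, so [#|u| - 1] suspensions remain
   to reach the stunted projective space. *)
pose D (u : {set 'I_r}) : ptopologicalType :=
  reduced_suspension R (thom e (~: u) u).
have desusp u := leaf_desuspension n_min u eE.
exists D; split=> [u u1|].
  by rewrite /is_desuspension /D -iterSr subn1 prednK ?(ltnW u1).
have [i hi] := pp_splitting n_min eE HE lE ce cH cl.
apply: (hcoproduct_unique hi (hcoproduct_pwedge (R := R) (summand R n D))) => u.
rewrite /summand; have := desusp u; rewrite /summand_base.
(* [h] concerns the [#|u|]-fold suspension, the goal the single one: at length 0 it is suspended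
   once more, at length 1 it is the goal, and from 2 on the summand is [D u] itself. *)
case: #|u| => [|[|k]] h.
- exact: bhe_susp.
- exact: h.
- exact: bhe_refl.
Qed.
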